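(* Let $p>0$, $M\in(0,1)$, let $q\in\mathcal C^1(\mathbb R_+,\mathbb R_+)$ be given by $q(x)=\frac x{(-\ln x)^p}$ for $x\in(0,\frac M{\sqrt2})$, and assume further that $0<q(x)<x$ and $|q'(x)|<1$ for every $x>0$. Let $x_0>0$, let $Q:\mathbb R_+\to\mathbb R_+$ be defined from $q$ by $$Q(x)=\frac1{\sqrt2}\left[2(q+\mathrm{Id})^{-1}(\sqrt2\,x)-\sqrt2\,x\right],$$ and let the sequence $(x_n)_{n\in\mathbb N}$ be given by $x_n=Q^{[n]}(x_0)$ for $n\ge0$. Set $N=\left\lfloor\frac1{2p}\right\rfloor$. Then there exist $N+1$ real numbers $\alpha_k$, $k\in\{0,\dots,N\}$, with $\alpha_0=\left(2(p+1)\right)^{\frac1{p+1}}$, such that, as $n\to+\infty$, $$x_n\sim\frac1{\sqrt2}\,e^{-\sum_{k=0}^N\alpha_kn^{\frac{1-2pk}{p+1}}}.$$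
   Context: $\mathbb R_+=[0,+\infty)$; $\mathrm{Id}$ is the identity function (under the hypotheses $q(0)=0$ and $q+\mathrm{Id}$ is an increasing bijection of $\mathbb R_+$); $Q^{[n]}$ is the $n$-th iterate of $Q$ under composition ($Q^{[0]}=\mathrm{Id}$); $\lfloor\cdot\rfloor$ is the floor function; $a_n\sim b_n$ means $a_n/b_n\to1$. *)

(* Defs.v *)
From Stdlib Require Import Reals ClassicalEpsilon.
From Coquelicot Require Import Coquelicot.
Open Scope R_scope.

(* A function R_+ -> R_+ is represented by a total function R -> R; nothing
   below depends on its values at negative arguments. *)
Definition Rplus_set (x : R) : Prop := 0 <= x.

(* Two-sided for x > 0; at x = 0 this is the right derivative. *)
Definition is_derive_Rplus (f : R -> R) (x l : R) : Prop :=
  filterlim (fun y => (f y - f x) / (y - x))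
            (within Rplus_set (locally' x)) (locally l).

Definition C1_Rplus (f : R -> R) : Prop :=
  exists df : R -> R,
    (forall x, Rplus_set x -> is_derive_Rplus f x (df x)) /\
    continuous_on Rplus_set df.

(* The inverse of f : R_+ -> R_+ when f is a bijection of R_+: the value at y
   is then the unique x >= 0 with f x = y (arbitrary if there is no such x). *)
Definition inv_Rplus (f : R -> R) (y : R) : R :=
  epsilon (inhabits 0) (fun x => Rplus_set x /\ f x = y).

Definition Q_of (q : R -> R) (x : R) : R :=
  1 / sqrt 2 * (2 * inv_Rplus (fun t => q t + t) (sqrt 2 * x) - sqrt 2 * x).

(* The floor of 1/(2p), which is nonnegative for p > 0. *)
Definition N_of (p : R) : nat := Z.to_nat (Int_part (1 / (2 * p))).

Definition equiv_seq (a b : nat -> R) : Prop :=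
  is_lim_seq (fun n => a n / b n) 1.

(* Main.v *)
Require Import Defs.
From Stdlib Require Import Reals Lra Lia List ZArith ClassicalEpsilon.
From Coquelicot Require Import Coquelicot.
Open Scope R_scope.

(** Write y n = sqrt 2 * x n. With u n the preimage of y n under Id + q, the
    definition of Q says y n = u n + q (u n) and y (n+1) = u n - q (u n).
    Hence y decreases, and since q is continuous and positive on the positive
    axis its limit can only be 0 (orbit_half_steps, half_step_orbit_to_0).

    In the variables z n = - ln (y n), t = - ln (u n) and tau = t^(-p), the
    explicit form of q near 0 gives z n = t - ln (1 + tau) and
    z (n+1) = t - ln (1 - tau). Therefore
      z (n+1) - z n = ln ((1 + tau) / (1 - tau)) = 2 (tau + tau^3/3 + ...),
    and replacing t by z n costs only O(z^(-2p-1)). So z satisfies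
      z (n+1) - z n = F (z n) + o(1/n),
    where F z = sum over j <= N of 2 / (2j+1) * z^(-p(2j+1)) is called
    increment below (log_orbit_recursion).

    The candidate solution is S n = sum over k <= N of alpha_k n^(beta_k), with
    beta_k = (1 - 2pk)/(p+1). Put v = n^(-2p/(p+1)) and
    A v = sum of alpha_k v^k; then S n = n^(1/(p+1)) * A v, and both
    S' n and F (S n) are n^(-p/(p+1)) times functions of v alone. Matching these
    two functions up to O(v^(N+1)) determines the alpha_k one after the other:
    order 0 forces alpha_0^(p+1) = 2 (p+1), and at order k >= 1 the unknown
    alpha_k appears with the factor (p + 1 - 2pk)/(p+1), which is positive
    because 2pk <= 2pN <= 1 (ansatz_coefficients). With these coefficients S
    satisfies the recursion of z up to o(1/n), because 2p(N+1) > 1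
    (ansatz_step).

    Finally F is decreasing, with a slope of exact order 1/n between z n and S n,
    because both have exact order n^(1/(p+1)). The difference e = z - S thus satisfies |e (n+1)| <= (1 - c/n) |e n| + o(1/n), which
    forces e n -> 0 (contraction_to_0, ansatz_approximates). Since
    x n = exp (- z n) / sqrt 2, this is the claimed equivalent. *)

(** * Orders of magnitude at 0+ *)

Lemma at_right_0_intro (P : R -> Prop) (d : R) :
  0 < d -> (forall v, 0 < v < d -> P v) -> at_right 0 P.
Proof.
intros Hd H. exists (mkposreal d Hd). intros v Hv Hpos.
apply H. split; [exact Hpos|].
unfold ball in Hv; simpl in Hv; unfold AbsRing_ball, abs, minus, plus, opp in Hv; simpl in Hv.
apply Rabs_def2 in Hv. lra.
Qed.

Lemma at_right_0_lt (d : R) : 0 < d -> at_right 0 (fun v => 0 < v < d).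
Proof. intros Hd. apply (at_right_0_intro _ d Hd); auto. Qed.

Lemma at_right_0_of_locally (P : R -> Prop) : locally 0 P -> at_right 0 P.
Proof. intros H. unfold at_right, within. revert H. apply filter_imp. auto. Qed.

Definition bigO (m : nat) (f : R -> R) : Prop :=
  exists C, at_right 0 (fun v => Rabs (f v) <= C * v ^ m).

Lemma bigO_ext m f g : at_right 0 (fun v => f v = g v) -> bigO m f -> bigO m g.
Proof.
intros E [C H]. exists C.
generalize (filter_and _ _ E H). apply filter_imp. now intros v [-> ?].
Qed.

Lemma bigO_plus m f g : bigO m f -> bigO m g -> bigO m (fun v => f v + g v).
Proof.
intros [C H] [C' H']. exists (C + C').
generalize (filter_and _ _ H H'). apply filter_imp. intros v [h h'].
eapply Rle_trans; [apply Rabs_triang|]. lra.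
Qed.

Lemma bigO_mult m m' f g :
  bigO m f -> bigO m' g -> bigO (m + m') (fun v => f v * g v).
Proof.
intros [C H] [C' H']. exists (C * C').
generalize (filter_and _ _ H H'). apply filter_imp. intros v [h h'].
rewrite Rabs_mult, pow_add.
replace (C * C' * (v ^ m * v ^ m')) with ((C * v ^ m) * (C' * v ^ m')) by ring.
apply Rmult_le_compat; auto; apply Rabs_pos.
Qed.

Lemma bigO_weaken m m' f : (m <= m')%nat -> bigO m' f -> bigO m f.
Proof.
intros Hm [C H]. exists (Rabs C).
generalize (filter_and _ _ H (at_right_0_lt 1 Rlt_0_1)). apply filter_imp.
intros v [h hv]. eapply Rle_trans; [exact h|].
eapply Rle_trans; [apply Rmult_le_compat_r; [apply pow_le; lra|apply Rle_abs]|].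
apply Rmult_le_compat_l; [apply Rabs_pos|].
replace m' with (m + (m' - m))%nat by lia. rewrite pow_add.
rewrite <- (Rmult_1_r (v ^ m)) at 2.
apply Rmult_le_compat_l; [apply pow_le; lra|].
rewrite <- (pow1 (m' - m)). apply pow_incr. lra.
Qed.

Lemma bigO_pow m : bigO m (fun v => v ^ m).
Proof.
exists 1. generalize (at_right_0_lt 1 Rlt_0_1). apply filter_imp.
intros v hv. rewrite Rabs_pos_eq; [lra|apply pow_le; lra].
Qed.

Lemma bigO_const c : bigO 0 (fun _ => c).
Proof. exists (Rabs c). apply filter_forall. intros v. simpl. lra. Qed.

Lemma bigO_scal m c f : bigO m f -> bigO m (fun v => c * f v).
Proof. intros H. exact (bigO_mult 0 m _ _ (bigO_const c) H). Qed.

Lemma bigO_minus m f g : bigO m f -> bigO m g -> bigO m (fun v => f v - g v).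
Proof.
intros Hf Hg. apply (bigO_ext m (fun v => f v + (-1) * g v)).
- apply filter_forall. intros v. ring.
- apply bigO_plus; [exact Hf|now apply bigO_scal].
Qed.

Lemma bigO_zero m : bigO m (fun _ => 0).
Proof.
exists 0. apply filter_forall. intros v. rewrite Rabs_R0. lra.
Qed.

Lemma bigO_continuous f : continuous f 0 -> bigO 0 f.
Proof.
intros H. exists (Rabs (f 0) + 1).
apply at_right_0_of_locally.
generalize (proj1 (filterlim_locally _ _) H (mkposreal 1 Rlt_0_1)).
apply filter_imp. intros v Hv.
unfold ball in Hv; simpl in Hv; unfold AbsRing_ball, abs, minus, plus, opp in Hv; simpl in Hv.
simpl. assert (Rabs (f v) <= Rabs (f v + - f 0) + Rabs (f 0)).
{ replace (f v) with ((f v + - f 0) + f 0) at 1 by ring. apply Rabs_triang. }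
lra.
Qed.

Lemma bigO_1_const a : bigO 1 (fun _ => a) -> a = 0.
Proof.
intros [C H]. destruct (Req_dec a 0) as [|Ha]; [assumption|exfalso].
assert (Hp : 0 < Rabs a) by now apply Rabs_pos_lt.
assert (HC : 0 < Rabs C + 1) by (generalize (Rabs_pos C); lra).
assert (Hd : 0 < Rabs a / (Rabs C + 1)) by now apply Rdiv_lt_0_compat.
destruct (filter_ex _ (filter_and _ _ H (at_right_0_lt _ Hd))) as [v [h [h1 h2]]].
simpl in h. rewrite Rmult_1_r in h.
apply (Rmult_lt_compat_l (Rabs C + 1)) in h2; [|lra].
replace ((Rabs C + 1) * (Rabs a / (Rabs C + 1))) with (Rabs a) in h2 by (field; lra).
generalize (Rmult_le_compat_r v _ _ (Rlt_le _ _ h1) (Rle_abs C)). lra.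
Qed.

(** * Polynomial expansions at 0+ *)

(** Horner form, constant coefficient first: dividing by v after a vanishing
    constant term is then taking the tail of the list. *)
Fixpoint peval (l : list R) (v : R) : R :=
  match l with nil => 0 | a :: l' => a + v * peval l' v end.

Lemma peval_plus l l' : exists l'', forall v, peval l'' v = peval l v + peval l' v.
Proof.
revert l'; induction l as [|a l IH]; intros l'.
- exists l'. intros v. simpl. ring.
- destruct l' as [|a' l'].
  + exists (a :: l). intros v. simpl. ring.
  + destruct (IH l') as [k Hk]. exists (a + a' :: k). intros v. simpl. rewrite Hk. ring.
Qed.

Lemma peval_scal c l : exists l', forall v, peval l' v = c * peval l v.
Proof.
induction l as [|a l [k Hk]].
- exists nil. intros v. simpl. ring.
- exists (c * a :: k). intros v. simpl. rewrite Hk. ring.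
Qed.

Lemma peval_mult l l' : exists l'', forall v, peval l'' v = peval l v * peval l' v.
Proof.
induction l as [|a l [k Hk]].
- exists nil. intros v. simpl. ring.
- destruct (peval_scal a l') as [k1 H1]. destruct (peval_plus k1 (0 :: k)) as [k2 H2].
  exists k2. intros v. rewrite H2. simpl. rewrite H1, Hk. ring.
Qed.

Lemma peval_derive l : exists l', forall v, is_derive (peval l) v (peval l' v).
Proof.
induction l as [|a l [k Hk]].
- exists nil. intros v. simpl. apply (is_derive_const (K := R_AbsRing) (V := R_NormedModule) 0 v).
- destruct (peval_plus l (0 :: k)) as [k2 H2]. exists k2. intros v.
  apply (is_derive_ext (fun v => a + v * peval l v)); [reflexivity|].
  auto_derive.
  + eexists. apply Hk.
  + rewrite H2. simpl. replace (Derive _ v) with (peval k v)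
      by (symmetry; apply is_derive_unique, Hk). ring.
Qed.

(** The induction on the coefficients shifts the power of v, so the primitive
    is needed for v^k times a polynomial and not only for k = 0. *)
Lemma peval_primitive k l :
  exists l', forall v, is_derive (fun v => v ^ S k * peval l' v) v (v ^ k * peval l v).
Proof.
revert k; induction l as [|a l IH]; intros k.
- exists nil. intros v. simpl.
  apply (is_derive_ext (fun _ => 0)). { intros t. symmetry. apply Rmult_0_r. }
  evar_last. apply (is_derive_const (K := R_AbsRing) (V := R_NormedModule) 0 v). unfold zero; simpl; ring.
- destruct (IH (S k)) as [l' Hl']. exists (a / INR (S k) :: l'). intros v.
  assert (Hk : INR (S k) <> 0) by (apply not_0_INR; lia).
  apply (is_derive_ext (fun v => a / INR (S k) * v ^ S k + v ^ S (S k) * peval l' v)).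
  { intros t. change (a / INR (S k) * t ^ S k + t ^ S (S k) * peval l' t
      = t ^ S k * (a / INR (S k) + t * peval l' t)). simpl. ring. }
  replace (v ^ k * peval (a :: l) v) with
    (a / INR (S k) * (INR (S k) * v ^ k) + v ^ S k * peval l v)
    by (cbn -[INR]; field; exact Hk).
  apply is_derive_Reals.
  apply (derivable_pt_lim_plus (fun v => a / INR (S k) * v ^ S k)
           (fun v => v ^ S (S k) * peval l' v)).
  + apply (derivable_pt_lim_scal (fun v => v ^ S k)). apply derivable_pt_lim_pow.
  + apply is_derive_Reals, Hl'.
Qed.

Lemma peval_bounded l : bigO 0 (peval l).
Proof.
apply bigO_continuous. destruct (peval_derive l) as [k Hk].
apply (ex_derive_continuous (V := R_NormedModule)). eexists. apply Hk.
Qed.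

(** A polynomial that is O(v) has no constant term; dividing by v lowers the
    order by one. *)
Lemma peval_factor m l :
  bigO m (peval l) -> exists l', forall v, peval l v = v ^ m * peval l' v.
Proof.
revert l; induction m as [|m IH]; intros l H.
- exists l. intros v. simpl. ring.
- destruct l as [|a l]. { exists nil. intros v. simpl. ring. }
  assert (Hc := peval_bounded l).
  assert (Ha : a = 0).
  { apply bigO_1_const.
    apply (bigO_ext 1 (fun v => peval (a :: l) v - v ^ 1 * peval l v)).
    - apply filter_forall. intros v. simpl. ring.
    - apply bigO_minus.
      + apply (bigO_weaken 1 (S m)); [lia|exact H].
      + apply (bigO_mult 1 0); [apply bigO_pow|exact Hc]. }
  subst a. destruct (IH l) as [l' Hl'].
  { destruct H as [C H]. exists C.
    generalize (filter_and _ _ H (at_right_0_lt 1 Rlt_0_1)). apply filter_imp.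
    intros v [h hv]. apply (Rmult_le_reg_l v); [lra|].
    simpl in h. rewrite Rplus_0_l, Rabs_mult, (Rabs_pos_eq v) in h by lra. lra. }
  exists l'. intros v. simpl. rewrite Hl'. ring.
Qed.

(** The degree of the polynomial is not bounded by the order of the remainder,
    so that products need no truncation. *)
Definition expandable (m : nat) (f : R -> R) : Prop :=
  exists l, bigO m (fun v => f v - peval l v).

Lemma expandable_ext m f g :
  at_right 0 (fun v => f v = g v) -> expandable m f -> expandable m g.
Proof.
intros E [l H]. exists l. revert H. apply bigO_ext.
revert E. apply filter_imp. now intros v ->.
Qed.

Lemma expandable_peval m l : expandable m (peval l).
Proof.
exists l. apply (bigO_ext m (fun _ => 0)); [|apply bigO_zero].
apply filter_forall. intros v. ring.
Qed.

Lemma expandable_bounded m f : expandable m f -> bigO 0 f.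
Proof.
intros [l H]. apply (bigO_ext 0 (fun v => (f v - peval l v) + peval l v)).
- apply filter_forall. intros v. ring.
- apply bigO_plus; [|apply peval_bounded]. apply (bigO_weaken 0 m); [lia|exact H].
Qed.

Lemma expandable_plus m f g :
  expandable m f -> expandable m g -> expandable m (fun v => f v + g v).
Proof.
intros [l H] [l' H']. destruct (peval_plus l l') as [k Hk]. exists k.
apply (bigO_ext m (fun v => (f v - peval l v) + (g v - peval l' v))).
- apply filter_forall. intros v. rewrite Hk. ring.
- now apply bigO_plus.
Qed.

Lemma expandable_mult m f g :
  expandable m f -> expandable m g -> expandable m (fun v => f v * g v).
Proof.
intros Hf Hg. assert (Bg := expandable_bounded m g Hg).
destruct Hf as [l H], Hg as [l' H']. destruct (peval_mult l l') as [k Hk]. exists k.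
apply (bigO_ext m (fun v => g v * (f v - peval l v) + peval l v * (g v - peval l' v))).
- apply filter_forall. intros v. rewrite Hk. ring.
- apply bigO_plus; apply (bigO_mult 0 m); auto using peval_bounded.
Qed.

Lemma expandable_const m c : expandable m (fun _ => c).
Proof.
apply (expandable_ext m (peval (c :: nil))); [|apply expandable_peval].
apply filter_forall. intros v. simpl. ring.
Qed.

Lemma expandable_id m : expandable m (fun v => v).
Proof.
apply (expandable_ext m (peval (0 :: 1 :: nil))); [|apply expandable_peval].
apply filter_forall. intros v. simpl. ring.
Qed.

Lemma expandable_pow m f k : expandable m f -> expandable m (fun v => f v ^ k).
Proof.
intros H. induction k as [|k IH]; simpl.
- apply expandable_const.
- now apply expandable_mult.
Qed.

Lemma expandable_sum m (f : nat -> R -> R) K :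
  (forall k, expandable m (f k)) -> expandable m (fun v => sum_f_R0 (fun k => f k v) K).
Proof.
intros H. induction K as [|K IH]; simpl; [apply H|]. apply expandable_plus; auto.
Qed.

(** This is how the first unmatched coefficient is read off: the polynomial
    part is divisible by v^m, and c is its coefficient of that order. *)
Lemma expandable_leading m f :
  expandable (S m) f -> bigO m f -> exists c, bigO (S m) (fun v => f v - c * v ^ m).
Proof.
intros [l H] Hf. destruct (peval_factor m l) as [l' Hl'].
{ apply (bigO_ext m (fun v => f v - (f v - peval l v))).
  - apply filter_forall. intros v. ring.
  - apply bigO_minus; [exact Hf|]. apply (bigO_weaken m (S m)); [lia|exact H]. }
destruct l' as [|c l'].
- exists 0. revert H. apply bigO_ext. apply filter_forall. intros v.
  rewrite Hl'. simpl. ring.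
- exists c.
  apply (bigO_ext (S m) (fun v => (f v - peval l v) + peval l' v * v ^ S m)).
  + apply filter_forall. intros v. rewrite Hl'. simpl. ring.
  + apply bigO_plus; [exact H|].
    apply (bigO_mult 0 (S m)); [apply peval_bounded|apply bigO_pow].
Qed.

(** Integrating gains one order: subtracting a primitive of the polynomial part
    of df leaves a function vanishing at 0 whose derivative is O(v^m), and the
    mean value theorem applies to it. *)
Lemma expandable_primitive m f df :
  locally 0 (fun v => is_derive f v (df v)) ->
  expandable m df -> expandable (S m) f.
Proof.
intros Hd [l [C H]]. destruct (peval_primitive 0 l) as [k Hk].
exists (f 0 :: k). exists (Rabs C).
destruct Hd as [d1 H1]. destruct H as [d2 H2].
apply (at_right_0_intro _ (Rmin d1 d2)).
{ apply Rmin_case; [apply cond_pos|apply cond_pos]. }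
intros v [Hv0 Hv].
assert (Hv1 : v < d1) by (eapply Rlt_le_trans; [exact Hv|apply Rmin_l]).
assert (Hv2 : v < d2) by (eapply Rlt_le_trans; [exact Hv|apply Rmin_r]).
assert (HB : forall (d : posreal) x, 0 <= x <= v -> v < d -> ball 0 d x).
{ intros d x Hx Hvd. unfold ball; simpl; unfold AbsRing_ball, abs, minus, plus, opp; simpl.
  apply Rabs_def1; lra. }
assert (Hg : forall x, 0 <= x <= v ->
  is_derive (fun v => f v - v ^ 1 * peval k v) x (df x - x ^ 0 * peval l x)).
{ intros x Hx. apply (is_derive_minus (K := R_AbsRing) (V := R_NormedModule)); [|apply Hk].
  apply H1. now apply HB. }
destruct (MVT_cor2 (fun v => f v - v ^ 1 * peval k v)
            (fun x => df x - x ^ 0 * peval l x) 0 v Hv0) as [c [E Hc]].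
{ intros x Hx. apply is_derive_Reals. now apply Hg. }
replace (f v - peval (f 0 :: k) v)
  with ((f v - v ^ 1 * peval k v) - (f 0 - 0 ^ 1 * peval k 0)) by (simpl; ring).
rewrite E. rewrite Rabs_mult, Rminus_0_r, (Rabs_pos_eq v) by lra.
cbn [pow]. rewrite (Rmult_comm v), <- Rmult_assoc.
apply Rmult_le_compat_r; [lra|].
assert (Hb := H2 c (HB d2 c ltac:(lra) Hv2) (proj1 Hc)).
rewrite Rmult_1_l. eapply Rle_trans; [exact Hb|].
apply Rle_trans with (Rabs C * c ^ m).
- apply Rmult_le_compat_r; [apply pow_le; lra|apply Rle_abs].
- apply Rmult_le_compat_l; [apply Rabs_pos|]. apply pow_incr. lra.
Qed.

(** * Real powers *)

Lemma Rpower_pos x r : 0 < Rpower x r.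
Proof. apply exp_pos. Qed.

Lemma Rpower_le_neg r a b : 0 <= r -> 0 < a <= b -> Rpower b (- r) <= Rpower a (- r).
Proof.
intros Hr Hab. rewrite !Rpower_Ropp. apply Rinv_le_contravar; [apply Rpower_pos|].
now apply Rle_Rpower_l.
Qed.

Lemma is_lim_seq_Rpower_neg (u : nat -> R) r :
  0 < r -> is_lim_seq u p_infty -> is_lim_seq (fun n => Rpower (u n) (- r)) 0.
Proof.
intros Hr Hu. apply is_lim_seq_spec. intros eps.
generalize (proj2 (is_lim_seq_spec _ _) Hu (exp (- ln eps / r))).
apply filter_imp. intros n Hn.
rewrite Rminus_0_r, Rabs_pos_eq by (apply Rlt_le, Rpower_pos).
unfold Rpower. rewrite <- (exp_ln eps) by apply cond_pos. apply exp_increasing.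
apply ln_increasing in Hn; [|apply exp_pos]. rewrite ln_exp in Hn.
apply (Rmult_lt_compat_l r) in Hn; [|exact Hr].
replace (r * (- ln eps / r)) with (- ln eps) in Hn by (field; lra). lra.
Qed.

Lemma Rpower_INR_pow x a k : Rpower x a ^ k = Rpower x (a * INR k).
Proof. rewrite <- Rpower_mult, Rpower_pow; [reflexivity|apply Rpower_pos]. Qed.

Lemma Rpower_MVT r a b : 0 < a -> 0 < b ->
  exists c, Rmin a b <= c <= Rmax a b /\
    Rpower b r - Rpower a r = r * Rpower c (r - 1) * (b - a).
Proof.
intros Ha Hb.
assert (Hm : 0 < Rmin a b) by now apply Rmin_case.
destruct (MVT_gen (fun x => Rpower x r) a b (fun x => r * Rpower x (r - 1))) as [c Hc].
- intros x Hx. apply is_derive_Reals. apply derivable_pt_lim_power. lra.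
- intros x Hx. apply derivable_continuous_pt. eexists. apply derivable_pt_lim_power. lra.
- now exists c.
Qed.

Lemma Rpower_locally_Lipschitz a r : 0 < a ->
  exists C d, 0 < d /\ forall x, Rabs (x - a) < d ->
    0 < x /\ Rabs (Rpower x r - Rpower a r) <= C * Rabs (x - a).
Proof.
intros Ha.
destruct (derivable_pt_lim_power a r Ha 1 Rlt_0_1) as [d Hd].
set (l := r * Rpower a (r - 1)) in Hd.
exists (Rabs l + 1), (Rmin d a). split; [apply Rmin_case; [apply cond_pos|exact Ha]|].
intros x Hx.
assert (H1 : Rabs (x - a) < d) by (eapply Rlt_le_trans; [exact Hx|apply Rmin_l]).
assert (H2 : Rabs (x - a) < a) by (eapply Rlt_le_trans; [exact Hx|apply Rmin_r]).
split; [apply Rabs_def2 in H2; lra|].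
destruct (Req_dec (x - a) 0) as [E|E].
{ replace x with a by lra. rewrite !Rminus_diag, Rabs_R0. lra. }
specialize (Hd (x - a) E H1). replace (a + (x - a)) with x in Hd by ring.
replace (Rpower x r - Rpower a r)
  with (((Rpower x r - Rpower a r) / (x - a) - l + l) * (x - a)) by (field; exact E).
rewrite Rabs_mult. apply Rmult_le_compat_r; [apply Rabs_pos|].
eapply Rle_trans; [apply Rabs_triang|]. lra.
Qed.

Lemma bigO_1_small f d : 0 < d -> bigO 1 f -> at_right 0 (fun v => Rabs (f v) < d).
Proof.
intros Hd [C H].
assert (HC : 0 < Rabs C + 1) by (generalize (Rabs_pos C); lra).
assert (Hd' : 0 < d / (Rabs C + 1)) by now apply Rdiv_lt_0_compat.
generalize (filter_and _ _ H (at_right_0_lt _ Hd')). apply filter_imp.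
intros v [h [h1 h2]]. simpl in h. rewrite Rmult_1_r in h.
apply (Rmult_lt_compat_l (Rabs C + 1)) in h2; [|lra].
replace ((Rabs C + 1) * (d / (Rabs C + 1))) with d in h2 by (field; lra).
generalize (Rmult_le_compat_r v _ _ (Rlt_le _ _ h1) (Rle_abs C)). lra.
Qed.

(** The derivative of P^r is r P^(r-1) P', a product of polynomials and of a
    power of the same kind. An induction on the order, for all exponents at
    once, therefore gives the expansion without any binomial series. *)
Lemma expandable_Rpower l r m : 0 < peval l 0 ->
  expandable m (fun v => Rpower (peval l v) r).
Proof.
intros H0. destruct (peval_derive l) as [l' Hl'].
assert (Hc : continuous (peval l) 0).
{ apply (ex_derive_continuous (V := R_NormedModule)). eexists. apply Hl'. }
assert (Hpos : locally 0 (fun v => 0 < peval l v)).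
{ apply (Hc (fun y => 0 < y)). now apply open_gt. }
assert (Hd : forall s, locally 0 (fun v => is_derive (fun v => Rpower (peval l v) s) v
            (s * Rpower (peval l v) (s - 1) * peval l' v))).
{ intros s. revert Hpos. apply filter_imp. intros v Hv.
  apply is_derive_Reals.
  apply (derivable_pt_lim_comp (peval l) (fun x => Rpower x s)).
  - apply is_derive_Reals, Hl'.
  - now apply derivable_pt_lim_power. }
revert r. induction m as [|m IH]; intros r.
- exists nil. apply bigO_continuous.
  apply (ex_derive_continuous (V := R_NormedModule)).
  apply (ex_derive_ext (fun v => Rpower (peval l v) r)).
  { intros t. symmetry. apply Rminus_0_r. }
  eexists. exact (locally_singleton _ _ (Hd r)).
- apply (expandable_primitive m _ _ (Hd r)).
  apply expandable_mult; [apply expandable_mult|].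
  + apply expandable_const.
  + apply IH.
  + apply expandable_peval.
Qed.

(** First-order effect of a perturbation of the base. The slope is taken at the
    common limit a instead of at f v, which costs one factor v because f and g
    are within O(v) of a. *)
Lemma bigO_Rpower_diff a r k f g : 0 < a ->
  bigO 1 (fun v => f v - a) -> bigO 1 (fun v => g v - a) ->
  bigO k (fun v => g v - f v) ->
  bigO (S k) (fun v => Rpower (g v) r - Rpower (f v) r
                       - r * Rpower a (r - 1) * (g v - f v)).
Proof.
intros Ha Hf Hg [C3 H3].
destruct (Rpower_locally_Lipschitz a (r - 1) Ha) as [C [d [Hd HC]]].
assert (Sf := bigO_1_small _ _ Hd Hf). assert (Sg := bigO_1_small _ _ Hd Hg).
destruct Hf as [C1 H1], Hg as [C2 H2].
exists (Rabs r * (Rabs C * (Rabs C1 + Rabs C2)) * C3).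
generalize (filter_and _ _ (filter_and _ _ Sf Sg) (filter_and _ _ (filter_and _ _ H1 H2)
  (filter_and _ _ H3 (at_right_0_lt 1 Rlt_0_1)))).
apply filter_imp. clear - HC. intros v [[sf sg] [[h1 h2] [h3 hv]]].
simpl in h1, h2. rewrite Rmult_1_r in h1, h2.
destruct (HC _ sf) as [Pf _]. destruct (HC _ sg) as [Pg _].
destruct (Rpower_MVT r (f v) (g v) Pf Pg) as [c [Hc ->]].
assert (Hca : Rabs (c - a) < d /\ Rabs (c - a) <= (Rabs C1 + Rabs C2) * v).
(* c lies between f v and g v, so it is no farther from a than one of them. *)
{ assert (Rabs (c - a) <= Rmax (Rabs (f v - a)) (Rabs (g v - a))).
  { revert Hc. unfold Rmin, Rmax. repeat destruct Rle_dec; intros Hc;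
    repeat (match goal with H : context [Rabs _] |- _ => revert H end);
    unfold Rabs; repeat destruct Rcase_abs; lra. }
  generalize (Rmult_le_compat_r v _ _ (Rlt_le _ _ (proj1 hv)) (Rle_abs C1)).
  generalize (Rmult_le_compat_r v _ _ (Rlt_le _ _ (proj1 hv)) (Rle_abs C2)).
  generalize (Rmult_le_pos _ _ (Rabs_pos C1) (Rlt_le _ _ (proj1 hv))).
  generalize (Rmult_le_pos _ _ (Rabs_pos C2) (Rlt_le _ _ (proj1 hv))).
  revert H. apply Rmax_case; intros; split; lra. }
destruct Hca as [Hc1 Hc2]. destruct (HC _ Hc1) as [_ Hp].
replace (r * Rpower c (r - 1) * (g v - f v) - r * Rpower a (r - 1) * (g v - f v))
  with (r * (Rpower c (r - 1) - Rpower a (r - 1)) * (g v - f v)) by ring.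
rewrite !Rabs_mult. cbn [pow].
replace (Rabs r * (Rabs C * (Rabs C1 + Rabs C2)) * C3 * (v * v ^ k))
  with (Rabs r * (Rabs C * ((Rabs C1 + Rabs C2) * v)) * (C3 * v ^ k)) by ring.
apply Rmult_le_compat; [| |apply Rmult_le_compat_l; [apply Rabs_pos|]|exact h3].
- apply Rmult_le_pos; apply Rabs_pos.
- apply Rabs_pos.
- eapply Rle_trans; [exact Hp|].
  eapply Rle_trans; [apply Rmult_le_compat_r; [apply Rabs_pos|apply Rle_abs]|].
  apply Rmult_le_compat_l; [apply Rabs_pos|exact Hc2].
Qed.

(** * The coefficients of the expansion *)

(** For v = s^2, the number s * artanh_sum N v b is the Taylor polynomial of
    ln ((1 + s b) / (1 - s b)) in s b, of degree 2N + 1. Keeping v apart makes it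
    a polynomial in v at fixed b. *)
Definition artanh_sum (N : nat) (v b : R) : R :=
  sum_f_R0 (fun j => 2 / (2 * INR j + 1) * v ^ j * b ^ (2 * j + 1)) N.

Lemma bigO_pow_diff k f g i :
  bigO 0 f -> bigO 0 g -> bigO k (fun v => f v - g v) ->
  bigO k (fun v => f v ^ i - g v ^ i).
Proof.
intros Hf Hg H.
assert (Hgi : forall i, bigO 0 (fun v => g v ^ i)).
{ clear - Hg. intros i. induction i as [|i IH]; simpl; [apply bigO_const|].
  now apply (bigO_mult 0 0). }
induction i as [|i IH].
- apply (bigO_ext k (fun _ => 0)); [|apply bigO_zero].
  apply filter_forall. intros v. simpl. ring.
- apply (bigO_ext k (fun v => f v * (f v ^ i - g v ^ i) + g v ^ i * (f v - g v))).
  + apply filter_forall. intros v. simpl. ring.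
  + apply bigO_plus; apply (bigO_mult 0 k); auto.
Qed.

(** Only the term j = 0, which is 2 b, acts at leading order: the others carry a
    factor v. *)
Lemma artanh_sum_linear N k f g :
  bigO 0 f -> bigO 0 g -> bigO k (fun v => f v - g v) ->
  bigO (S k) (fun v => artanh_sum N v (f v) - artanh_sum N v (g v) - 2 * (f v - g v)).
Proof.
intros Hf Hg H. induction N as [|N IH].
- apply (bigO_ext (S k) (fun _ => 0)); [|apply bigO_zero].
  apply filter_forall. intros v. unfold artanh_sum. simpl. field.
- apply (bigO_ext (S k) (fun v =>
    (artanh_sum N v (f v) - artanh_sum N v (g v) - 2 * (f v - g v)) +
    2 / (2 * INR (S N) + 1) *
      (v ^ S N * (f v ^ (2 * S N + 1) - g v ^ (2 * S N + 1))))).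
  + apply filter_forall. intros v. unfold artanh_sum.
    rewrite !tech5. ring.
  + apply bigO_plus; [exact IH|]. apply bigO_scal.
    apply (bigO_weaken (S k) (S N + k)); [lia|].
    apply bigO_mult; [apply bigO_pow|]. now apply bigO_pow_diff.
Qed.

Lemma artanh_sum_0 N v : artanh_sum N v 0 = 0.
Proof.
unfold artanh_sum. apply sum_eq_R0. intros j _.
rewrite Nat.add_1_r. simpl. ring.
Qed.

Lemma peval_sum (alpha : nat -> R) K :
  exists l, forall v, peval l v = sum_f_R0 (fun k => alpha k * v ^ k) K.
Proof.
assert (Hmon : forall c k, exists l, forall v, peval l v = c * v ^ k).
{ intros c k. induction k as [|k [l Hl]].
  - exists (c :: nil). intros v. simpl. ring.
  - exists (0 :: l). intros v. simpl. rewrite Hl. ring. }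
induction K as [|K [l Hl]].
- destruct (Hmon (alpha 0%nat) 0%nat) as [l Hl]. exists l. intros v. rewrite Hl. reflexivity.
- destruct (Hmon (alpha (S K)) (S K)) as [l1 H1]. destruct (peval_plus l l1) as [l2 H2].
  exists l2. intros v. rewrite H2, Hl, H1. reflexivity.
Qed.

Lemma bigO_sum_minus_head (alpha : nat -> R) K :
  bigO 1 (fun v => sum_f_R0 (fun k => alpha k * v ^ k) K - alpha 0%nat).
Proof.
induction K as [|K IH].
- apply (bigO_ext 1 (fun _ => 0)); [|apply bigO_zero].
  apply filter_forall. intros v. simpl. ring.
- apply (bigO_ext 1 (fun v => (sum_f_R0 (fun k => alpha k * v ^ k) K - alpha 0%nat)
    + alpha (S K) * v ^ S K)).
  + apply filter_forall. intros v. rewrite tech5. ring.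
  + apply bigO_plus; [exact IH|]. apply bigO_scal.
    apply (bigO_weaken 1 (S K)); [lia|apply bigO_pow].
Qed.

(** The coefficients are built one at a time. Adding a v^k to the sum A changes
    artanh_sum N v (A^(-p)) by - 2 p a alpha_0^(-p-1) v^k at leading order,
    that is by - a p/(p+1) v^k, and changes the other sum by a (1-2pk)/(p+1) v^k.
    The mismatch at order v^k therefore depends on a through the factor
    (p + 1 - 2pk)/(p+1), which is not zero as long as 2pk <= 1. *)
Lemma ansatz_coefficients p N : 0 < p -> 2 * p * INR N <= 1 ->
  exists alpha : nat -> R,
    alpha 0%nat = Rpower (2 * (p + 1)) (1 / (p + 1)) /\
    bigO (S N) (fun v =>
      artanh_sum N v (Rpower (sum_f_R0 (fun k => alpha k * v ^ k) N) (- p))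
      - sum_f_R0 (fun k => alpha k * ((1 - 2 * p * INR k) / (p + 1)) * v ^ k) N).
Proof.
intros Hp HN. set (a0 := Rpower (2 * (p + 1)) (1 / (p + 1))).
assert (Ha0 : 0 < a0) by apply Rpower_pos.
assert (Hpow : Rpower a0 (- p - 1) = / (2 * (p + 1))).
{ unfold a0. rewrite Rpower_mult.
  replace (1 / (p + 1) * (- p - 1)) with (- (1)) by (field; lra).
  rewrite Rpower_Ropp, Rpower_1; lra. }
assert (Hpow' : Rpower a0 (- p) = a0 / (2 * (p + 1))).
{ replace (- p) with ((- p - 1) + 1) by ring.
  rewrite Rpower_plus, Rpower_1, Hpow by exact Ha0. field. lra. }
enough (HK : forall K, (K <= N)%nat -> exists alpha : nat -> R, alpha 0%nat = a0 /\
    bigO (S K) (fun v =>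
      artanh_sum N v (Rpower (sum_f_R0 (fun k => alpha k * v ^ k) K) (- p))
      - sum_f_R0 (fun k => alpha k * ((1 - 2 * p * INR k) / (p + 1)) * v ^ k) K))
  by now apply HK.
induction K as [|K IH]; intros HKN.
- exists (fun _ => a0). split; [reflexivity|].
  apply (bigO_ext 1 (fun v => artanh_sum N v (Rpower a0 (- p)) - artanh_sum N v 0
                              - 2 * (Rpower a0 (- p) - 0))).
  + apply filter_forall. intros v. rewrite artanh_sum_0. simpl.
    rewrite !Rmult_1_r, Hpow'. field. lra.
  + apply (artanh_sum_linear N 0 (fun _ => Rpower a0 (- p)) (fun _ => 0));
    apply bigO_const.
- destruct (IH ltac:(lia)) as [alpha [Halpha HO]].
  destruct (peval_sum alpha K) as [l Hl].
  destruct (peval_sum (fun k => alpha k * ((1 - 2 * p * INR k) / (p + 1))) K) as [l' Hl'].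
  assert (Hl0 : peval l 0 = a0).
  { rewrite Hl, <- Halpha. clear. induction K as [|K IH]; simpl; [ring|].
    rewrite IH. ring. }
  assert (HE : forall m, expandable m (fun v =>
      Rpower (sum_f_R0 (fun k => alpha k * v ^ k) K) (- p))).
  { intros m. apply (expandable_ext m (fun v => Rpower (peval l v) (- p))).
    - apply filter_forall. intros v. now rewrite Hl.
    - apply expandable_Rpower. rewrite Hl0. exact Ha0. }
  match type of HO with bigO _ ?h => assert (Hexp : expandable (S (S K)) h) end.
  { apply (expandable_ext (S (S K)) (fun v =>
      artanh_sum N v (Rpower (sum_f_R0 (fun k => alpha k * v ^ k) K) (- p))
      + (-1) * peval l' v)).
    - apply filter_forall. intros v. rewrite Hl'. ring.
    - apply expandable_plus.
      + apply expandable_sum. intros j. apply expandable_mult; [apply expandable_mult|].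
        * apply expandable_const.
        * apply expandable_pow, expandable_id.
        * apply expandable_pow, HE.
      + apply expandable_mult; [apply expandable_const|apply expandable_peval]. }
  destruct (expandable_leading _ _ Hexp HO) as [c Hc].
  assert (Hden : p + 1 - 2 * p * INR (S K) > 0).
  { apply le_INR in HKN. assert (p * INR (S K) <= p * INR N) by (apply Rmult_le_compat_l; lra).
    lra. }
  (* c is the mismatch at order S K; a is the solution of the linear equation
     cancelling it. *)
  set (a := c * (p + 1) / (p + 1 - 2 * p * INR (S K))).
  set (alpha' := fun k => if Nat.eq_dec k (S K) then a else alpha k).
  exists alpha'. split. { unfold alpha'. now destruct Nat.eq_dec. }
  assert (Hsum : forall w : nat -> R -> R, forall v,
    sum_f_R0 (fun k => alpha' k * w k v) (S K)
    = sum_f_R0 (fun k => alpha k * w k v) K + a * w (S K) v).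
  { intros w v. rewrite tech5. f_equal.
    - apply sum_eq. intros k Hk. unfold alpha'. destruct Nat.eq_dec; [lia|reflexivity].
    - unfold alpha'. now destruct Nat.eq_dec. }
  set (f := fun v => sum_f_R0 (fun k => alpha k * v ^ k) K).
  set (g := fun v => f v + a * v ^ S K).
  assert (Hf1 : bigO 1 (fun v => f v - a0)).
  { rewrite <- Halpha. apply bigO_sum_minus_head. }
  assert (Hgf : bigO (S K) (fun v => g v - f v)).
  { apply (bigO_ext (S K) (fun v => a * v ^ S K)).
    - apply filter_forall. intros v. unfold g. ring.
    - apply bigO_scal, bigO_pow. }
  assert (Hg1 : bigO 1 (fun v => g v - a0)).
  { apply (bigO_ext 1 (fun v => (f v - a0) + (g v - f v))).
    - apply filter_forall. intros v. ring.
    - apply bigO_plus; [exact Hf1|]. apply (bigO_weaken 1 (S K)); [lia|exact Hgf]. }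
  assert (HP := bigO_Rpower_diff a0 (- p) (S K) f g Ha0 Hf1 Hg1 Hgf).
  assert (Bf : bigO 0 (fun v => Rpower (f v) (- p))) by exact (expandable_bounded 0 _ (HE 0%nat)).
  assert (Hdiff : bigO (S K) (fun v => Rpower (g v) (- p) - Rpower (f v) (- p))).
  { apply (bigO_ext (S K) (fun v => (Rpower (g v) (- p) - Rpower (f v) (- p)
                       - - p * Rpower a0 (- p - 1) * (g v - f v))
                       + - p * Rpower a0 (- p - 1) * (g v - f v))).
    - apply filter_forall. intros v. ring.
    - apply bigO_plus; [apply (bigO_weaken _ (S (S K))); [lia|exact HP]|].
      apply bigO_scal, Hgf. }
  assert (Bg : bigO 0 (fun v => Rpower (g v) (- p))).
  { apply (bigO_ext 0 (fun v => (Rpower (g v) (- p) - Rpower (f v) (- p)) + Rpower (f v) (- p))).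
    - apply filter_forall. intros v. ring.
    - apply bigO_plus; [|exact Bf]. apply (bigO_weaken 0 (S K)); [lia|exact Hdiff]. }
  assert (HL := artanh_sum_linear N (S K) _ _ Bg Bf Hdiff).
  assert (HT := bigO_plus _ _ _ Hc (bigO_plus _ _ _ HL (bigO_scal _ 2 _ HP))).
  revert HT. apply bigO_ext. apply filter_forall. intros v.
  rewrite (Hsum (fun k v => v ^ k)).
  replace (sum_f_R0 (fun k => alpha' k * ((1 - 2 * p * INR k) / (p + 1)) * v ^ k) (S K))
    with (sum_f_R0 (fun k => alpha k * ((1 - 2 * p * INR k) / (p + 1)) * v ^ k) K
          + a * ((1 - 2 * p * INR (S K)) / (p + 1)) * v ^ S K).
  2:{ rewrite Rmult_assoc.
      rewrite (sum_eq _ (fun k => alpha k * (((1 - 2 * p * INR k) / (p + 1)) * v ^ k)))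
        by (intros; ring).
      rewrite <- (Hsum (fun k v => ((1 - 2 * p * INR k) / (p + 1)) * v ^ k)).
      apply sum_eq. intros. ring. }
  change (sum_f_R0 (fun k => alpha k * v ^ k) K) with (f v).
  change (f v + a * v ^ S K) with (g v).
  replace (g v - f v) with (a * v ^ S K) by (unfold g; ring).
  rewrite Hpow.
  enough (E : c = a * (p / (p + 1) + (1 - 2 * p * INR (S K)) / (p + 1))).
  { rewrite E. field. lra. }
  unfold a. field. lra.
Qed.

(** * The increment function *)

Lemma is_derive_artanh_sum N t :
  is_derive (artanh_sum N 1) t (2 * sum_f_R0 (fun j => (t ^ 2) ^ j) N).
Proof.
induction N as [|N IH].
- apply (is_derive_ext (fun b => 2 * b)).
  { intros b. unfold artanh_sum. change (2 * b = 2 / (2 * INR 0 + 1) * 1 ^ 0 * b ^ (2 * 0 + 1)).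
    simpl. field. }
  auto_derive; [trivial|]. simpl. ring.
- apply (is_derive_ext (fun b => artanh_sum N 1 b
    + 2 / (2 * INR (S N) + 1) * b ^ (2 * S N + 1))).
  { intros b. unfold artanh_sum. rewrite tech5, pow1, Rmult_1_r. reflexivity. }
  rewrite tech5, Rmult_plus_distr_l.
  apply is_derive_Reals.
  apply (derivable_pt_lim_plus (artanh_sum N 1)
    (fun b => 2 / (2 * INR (S N) + 1) * b ^ (2 * S N + 1))).
  + now apply is_derive_Reals.
  + replace (2 * (t ^ 2) ^ S N)
      with (2 / (2 * INR (S N) + 1) * (INR (2 * S N + 1) * t ^ pred (2 * S N + 1))).
    * apply (derivable_pt_lim_scal (fun b => b ^ (2 * S N + 1))). apply derivable_pt_lim_pow.
    * rewrite <- pow_mult. replace (pred (2 * S N + 1)) with (2 * S N)%nat by lia.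
      rewrite plus_INR, mult_INR. change (INR 2) with 2. change (INR 1) with 1.
      field. generalize (pos_INR (S N)). lra.
Qed.

Lemma geometric_bounds N w : 0 <= w <= 1 / 4 ->
  1 <= sum_f_R0 (fun j => w ^ j) N <= 2.
Proof.
intros Hw. rewrite tech3 by lra.
assert (0 <= w ^ S N <= w).
{ split; [apply pow_le; lra|]. rewrite <- (Rmult_1_r w) at 2. simpl.
  apply Rmult_le_compat_l; [lra|]. rewrite <- (pow1 N). apply pow_incr. lra. }
split; apply (Rmult_le_reg_r (1 - w)); try lra; unfold Rdiv;
  rewrite Rmult_assoc, Rinv_l by lra; nra.
Qed.

Lemma artanh_sum_MVT N a b : 0 <= a <= 1 / 2 -> 0 <= b <= 1 / 2 ->
  exists k, 2 <= k <= 4 /\ artanh_sum N 1 b - artanh_sum N 1 a = k * (b - a).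
Proof.
intros Ha Hb.
destruct (MVT_gen (artanh_sum N 1) a b
            (fun t => 2 * sum_f_R0 (fun j => (t ^ 2) ^ j) N)) as [c [Hc E]].
- intros x _. apply is_derive_artanh_sum.
- intros x _. apply continuity_pt_filterlim, (ex_derive_continuous (V := R_NormedModule)).
  eexists. apply is_derive_artanh_sum.
- eexists. split; [|exact E].
  assert (0 <= c <= 1 / 2).
  { revert Hc. unfold Rmin, Rmax. destruct Rle_dec; lra. }
  assert (H1 : 0 <= c ^ 2 <= 1 / 4) by nra.
  generalize (geometric_bounds N _ H1). lra.
Qed.

(** The derivative of the difference is the remainder 2 t^(2N+2) / (1 - t^2) of
    a geometric series. *)
Lemma ln_minus_artanh_sum N t : 0 < t <= 1 / 2 ->
  Rabs (ln (1 + t) - ln (1 - t) - artanh_sum N 1 t) <= 4 * t ^ (2 * N + 3).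
Proof.
intros Ht.
assert (Hd : forall x, 0 <= x <= t ->
  derivable_pt_lim (fun x => ln (1 + x) - ln (1 - x) - artanh_sum N 1 x) x
    (/ (1 + x) + / (1 - x) - 2 * sum_f_R0 (fun j => (x ^ 2) ^ j) N)).
{ intros x Hx.
  apply (derivable_pt_lim_minus (fun x => ln (1 + x) - ln (1 - x)) (artanh_sum N 1)).
  - apply is_derive_Reals. auto_derive; [lra|]. field. lra.
  - apply is_derive_Reals, is_derive_artanh_sum. }
destruct (MVT_cor2 _ _ 0 t (proj1 Ht) Hd) as [c [E Hc]].
replace (ln (1 + 0) - ln (1 - 0) - artanh_sum N 1 0) with 0 in E
  by (rewrite artanh_sum_0, Rplus_0_r, !Rminus_0_r, ln_1; ring).
rewrite Rminus_0_r in E. rewrite E, Rminus_0_r.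
assert (Hc2 : 0 <= c ^ 2 <= 1 / 4) by nra.
assert (Hne : 1 - c ^ 2 <> 0) by lra.
rewrite tech3 by lra.
replace (/ (1 + c) + / (1 - c) - 2 * ((1 - (c ^ 2) ^ S N) / (1 - c ^ 2)))
  with (2 * (c ^ 2) ^ S N * / (1 - c ^ 2)).
2:{ replace (/ (1 + c) + / (1 - c)) with (2 * / (1 - c ^ 2)).
    - field. exact Hne.
    - field. split; [lra|split; [lra|exact Hne]]. }
assert (Hi : 0 < / (1 - c ^ 2) <= 2).
{ split; [apply Rinv_0_lt_compat; lra|].
  replace 2 with (/ / 2) by field. apply Rinv_le_contravar; lra. }
assert (Hp : 0 <= (c ^ 2) ^ S N <= t ^ (2 * S N)).
{ split; [apply pow_le; lra|]. rewrite <- pow_mult. apply pow_incr. lra. }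
replace (2 * N + 3)%nat with (2 * S N + 1)%nat by lia. rewrite pow_add, pow_1.
rewrite Rabs_pos_eq.
2:{ apply Rmult_le_pos; [apply Rmult_le_pos|]; lra. }
rewrite <- Rmult_assoc. apply Rmult_le_compat_r; [lra|].
apply Rle_trans with (2 * (c ^ 2) ^ S N * 2).
- apply Rmult_le_compat_l; lra.
- lra.
Qed.

(** The approximate step of - ln (sqrt 2 * x n) as a function of its value. *)
Definition increment (p : R) (N : nat) (z : R) : R := artanh_sum N 1 (Rpower z (- p)).

Lemma increment_bounds p N z : 0 < z -> Rpower z (- p) <= 1 / 2 ->
  2 * Rpower z (- p) <= increment p N z <= 4 * Rpower z (- p).
Proof.
intros Hz H. assert (Hp := Rpower_pos z (- p)).
destruct (artanh_sum_MVT N 0 (Rpower z (- p))) as [k [Hk E]]; [lra|lra|].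
rewrite artanh_sum_0, !Rminus_0_r in E. unfold increment. rewrite E. nra.
Qed.

(** The derivative is put in the form - p k c^(-(p+1)) with a bounded factor k,
    because only its order of magnitude is used. *)
Lemma increment_MVT p N a b : 0 < p -> 0 < a -> 0 < b ->
  Rpower (Rmin a b) (- p) <= 1 / 2 ->
  exists c k, Rmin a b <= c <= Rmax a b /\ 2 <= k <= 4 /\
    increment p N b - increment p N a = - (p * k * Rpower c (- (p + 1))) * (b - a).
Proof.
intros Hp Ha Hb H.
assert (Hm : 0 < Rmin a b) by now apply Rmin_case.
destruct (Rpower_MVT (- p) a b Ha Hb) as [c [Hc E]].
assert (HX : forall x, Rmin a b <= x -> 0 <= Rpower x (- p) <= 1 / 2).
{ intros x Hx. split; [apply Rlt_le, Rpower_pos|]. eapply Rle_trans; [|exact H].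
  apply Rpower_le_neg; lra. }
destruct (artanh_sum_MVT N (Rpower a (- p)) (Rpower b (- p))) as [k [Hk E']].
{ apply HX, Rmin_l. } { apply HX, Rmin_r. }
exists c, k. split; [exact Hc|split; [exact Hk|]].
unfold increment. rewrite E', E. replace (- (p + 1)) with (- p - 1) by ring. ring.
Qed.

(** This homogeneity reduces the asymptotics in n to one-variable expansions in
    v = s^2. *)
Lemma artanh_sum_scale N s b : artanh_sum N 1 (s * b) = s * artanh_sum N (s ^ 2) b.
Proof.
unfold artanh_sum. rewrite scal_sum. apply sum_eq. intros j _.
rewrite pow1, Rpow_mult_distr, <- pow_mult, (pow_add s), pow_1. ring.
Qed.

(** * Recursions with step of order 1/n *)

(** Above any level e, the excess a n - e is multiplied by at most 1 - c/n as soon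
    as b n <= c e / n, and the product of these factors is bounded by a multiple
    of n^(-c). *)
Lemma contraction_to_0 (a b : nat -> R) c :
  0 < c -> (forall n, 0 <= a n) ->
  eventually (fun n => a (S n) <= (1 - c / INR n) * a n + b n) ->
  is_lim_seq (fun n => INR n * b n) 0 -> is_lim_seq a 0.
Proof.
intros Hc Ha Hrec Hb. apply is_lim_seq_spec. intros eps.
set (e := pos_div_2 eps). assert (He : 0 < e) by apply cond_pos.
assert (Hbig : eventually (fun n => c + 1 < INR n)).
{ apply (proj2 (is_lim_seq_spec _ _) is_lim_seq_INR). }
assert (Hbe : eventually (fun n => Rabs (INR n * b n - 0) < c * e)).
{ apply (proj2 (is_lim_seq_spec _ _) Hb (mkposreal _ (Rmult_lt_0_compat _ _ Hc He))). }
destruct (filter_and _ _ Hrec (filter_and _ _ Hbig Hbe)) as [n1 H1].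
(* K makes the bound K n^(-c) on the excess hold at n1. *)
set (K := Rmax (a n1 - e) 0 * Rpower (INR n1) c).
assert (HK : 0 <= K).
{ apply Rmult_le_pos; [apply Rmax_r|apply Rlt_le, Rpower_pos]. }
assert (Hbound : forall n, (n1 <= n)%nat -> a n - e <= K * Rpower (INR n) (- c)).
{ intros n Hn. induction Hn as [|n Hn IH].
  - unfold K. rewrite Rmult_assoc, <- Rpower_plus, Rplus_opp_r, Rpower_O, Rmult_1_r.
    + apply Rmax_l.
    + destruct (H1 n1 (le_n _)) as [_ [H _]]. lra.
  - destruct (H1 n Hn) as [Hr [Hn1 Hbn]].
    set (x := INR n) in *. assert (Hx : 0 < x) by lra.
    assert (Hcx : c / x < 1).
    { apply (Rmult_lt_reg_r x); [exact Hx|]. unfold Rdiv.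
      rewrite Rmult_assoc, Rinv_l by lra. lra. }
    assert (Hbx : b n <= c / x * e).
    { apply (Rmult_le_reg_l x); [exact Hx|].
      replace (x * (c / x * e)) with (c * e) by (field; lra).
      rewrite Rminus_0_r in Hbn. apply Rabs_def2 in Hbn. lra. }
    apply Rle_trans with ((1 - c / x) * (a n - e)); [lra|].
    apply Rle_trans with ((1 - c / x) * (K * Rpower x (- c))).
    { apply Rmult_le_compat_l; lra. }
    replace ((1 - c / x) * (K * Rpower x (- c)))
      with (K * ((1 - c / x) * Rpower x (- c))) by ring.
    apply Rmult_le_compat_l; [exact HK|].
    (* 1 - c/x <= exp (- c/x), and ln (x + 1) <= ln x + 1/x. *)
    apply Rle_trans with (exp (- (c / x)) * Rpower x (- c)).
    { apply Rmult_le_compat_r; [apply Rlt_le, Rpower_pos|].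
      generalize (exp_ineq1_le (- (c / x))). lra. }
    unfold Rpower. rewrite <- exp_plus.
    apply Rnot_lt_le. intros Hexp. apply exp_lt_inv in Hexp. revert Hexp.
    apply Rle_not_lt.
    rewrite S_INR. fold x.
    replace (x + 1) with (x * (1 + / x)) by (field; lra).
    assert (0 < / x) by now apply Rinv_0_lt_compat.
    rewrite ln_mult by lra.
    assert (ln (1 + / x) <= / x).
    { rewrite <- (ln_exp (/ x)) at 2. apply ln_le; [lra|]. apply exp_ineq1_le. }
    unfold Rdiv. nra. }
assert (HlimK : is_lim_seq (fun n => K * Rpower (INR n) (- c)) 0).
{ replace (Finite 0) with (Rbar_mult K 0) by (simpl; f_equal; ring).
  apply is_lim_seq_scal_l. apply is_lim_seq_Rpower_neg; [exact Hc|apply is_lim_seq_INR]. }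
generalize (filter_and _ _ (proj2 (is_lim_seq_spec _ _) HlimK e)
              (ex_intro (fun N => forall n, (N <= n)%nat -> (n1 <= n)%nat) n1 (fun n h => h))).
apply filter_imp. intros n [Hn1 Hn2].
specialize (Hbound n Hn2). rewrite Rminus_0_r in Hn1. rewrite Rminus_0_r.
rewrite Rabs_pos_eq by apply Ha. apply Rabs_def2 in Hn1.
assert (pos eps = e + e) by (unfold e; simpl; field). lra.
Qed.

Lemma linear_growth (W : nat -> R) c C : 0 < c ->
  eventually (fun n => c <= W (S n) - W n <= C) ->
  exists c' C', 0 < c' /\ eventually (fun n => c' * INR n <= W n <= C' * INR n).
Proof.
intros Hc [n0 H].
assert (HC : 0 <= C) by (specialize (H n0 (le_n _)); lra).
(* Half of the slope c absorbs the initial value once n is large. *)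
exists (c / 2), (Rabs (W n0) + C). split; [lra|].
assert (Hb : forall n, (n0 <= n)%nat ->
  W n0 + c * (INR n - INR n0) <= W n <= W n0 + C * (INR n - INR n0)).
{ intros n Hn. induction Hn as [|n Hn IH]; [lra|].
  specialize (H n Hn). rewrite S_INR. lra. }
generalize (filter_and _ _ (proj2 (is_lim_seq_spec _ _) is_lim_seq_INR
    (Rmax 1 (2 / c * (c * INR n0 - W n0))))
  (ex_intro (fun N => forall n, (N <= n)%nat -> (n0 <= n)%nat) n0 (fun n h => h))).
apply filter_imp. intros n [Hn1 Hn2]. specialize (Hb n Hn2).
assert (H1 := Rmax_l 1 (2 / c * (c * INR n0 - W n0))).
assert (H2 := Rmax_r 1 (2 / c * (c * INR n0 - W n0))).
assert (H3 : 2 / c * (c * INR n0 - W n0) < INR n) by lra.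
apply (Rmult_lt_compat_l (c / 2)) in H3; [|lra].
replace (c / 2 * (2 / c * (c * INR n0 - W n0))) with (c * INR n0 - W n0) in H3 by (field; lra).
split; [lra|].
generalize (Rle_abs (W n0)) (Rabs_pos (W n0)) (pos_INR n0). nra.
Qed.

(** The sequence z^(p+1) has increments of order z^p (z (n+1) - z n), hence
    bounded above and below by positive constants. *)
Lemma increments_growth p (z : nat -> R) k K : 0 < p -> 0 < k ->
  is_lim_seq z p_infty ->
  eventually (fun n => k * Rpower (z n) (- p) <= z (S n) - z n <= K * Rpower (z n) (- p)) ->
  exists c C, 0 < c /\
    eventually (fun n => c * INR n <= Rpower (z n) (p + 1) <= C * INR n).
Proof.
intros Hp Hk Hz H.
apply (linear_growth _ ((p + 1) * k) ((p + 1) * (K * Rpower 2 p))).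
{ apply Rmult_lt_0_compat; lra. }
generalize (filter_and _ _ H (proj2 (is_lim_seq_spec _ _) Hz (Rmax 1 K))).
apply filter_imp. intros n [[H1 H2] H3].
set (x := z n) in *. set (y := z (S n)) in *.
assert (Hx1 : 1 < x) by (eapply Rle_lt_trans; [apply Rmax_l|exact H3]).
assert (HxK : K < x) by (eapply Rle_lt_trans; [apply Rmax_r|exact H3]).
assert (Hxp := Rpower_pos x (- p)).
assert (Hxp1 : Rpower x (- p) <= 1).
{ rewrite <- (Rpower_O x) by lra. apply Rle_Rpower; lra. }
assert (HK : 0 < K) by nra.
assert (Hxy : x <= y) by nra.
assert (Hy2 : y <= 2 * x) by nra.
destruct (Rpower_MVT (p + 1) x y) as [c [Hc E]]; [lra|lra|].
rewrite Rmin_left, Rmax_right in Hc by lra.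
rewrite E. replace (p + 1 - 1) with p by ring.
assert (Hcl : Rpower x p <= Rpower c p) by (apply Rle_Rpower_l; lra).
assert (Hcu : Rpower c p <= Rpower 2 p * Rpower x p).
{ rewrite Rpower_mult_distr by lra. apply Rle_Rpower_l; lra. }
assert (Hinv : Rpower x p * Rpower x (- p) = 1).
{ rewrite <- Rpower_plus, Rplus_opp_r. apply Rpower_O. lra. }
assert (Hxpp := Rpower_pos x p). assert (H2p := Rpower_pos 2 p).
rewrite !Rmult_assoc. split; apply Rmult_le_compat_l; try lra.
- apply Rle_trans with (Rpower x p * (k * Rpower x (- p))).
  + replace (Rpower x p * (k * Rpower x (- p))) with (k * (Rpower x p * Rpower x (- p))) by ring.
    rewrite Hinv. lra.
  + apply Rmult_le_compat; try lra. apply Rmult_le_pos; lra.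
- apply Rle_trans with ((Rpower 2 p * Rpower x p) * (K * Rpower x (- p))).
  + apply Rmult_le_compat; try lra.
  + replace (Rpower 2 p * Rpower x p * (K * Rpower x (- p)))
      with (K * Rpower 2 p * (Rpower x p * Rpower x (- p))) by ring.
    rewrite Hinv. lra.
Qed.

(** * The truncated expansion as an approximate solution *)

(** The error is a second derivative, of order n^(b-2). *)
Lemma power_step b : b < 1 ->
  is_lim_seq (fun n => INR n * (Rpower (INR (S n)) b - Rpower (INR n) b
                                - b * Rpower (INR n) (b - 1))) 0.
Proof.
intros Hb.
apply (is_lim_seq_le_le_loc (fun n => - (Rabs (b * (b - 1)) * Rpower (INR n) (- (1 - b)))) _
        (fun n => Rabs (b * (b - 1)) * Rpower (INR n) (- (1 - b)))).
- generalize (proj2 (is_lim_seq_spec _ _) is_lim_seq_INR 0). apply filter_imp.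
  intros n Hn. apply Rabs_le_between. rewrite S_INR. set (x := INR n) in *.
  destruct (Rpower_MVT b x (x + 1)) as [c [Hc E]]; [lra|lra|].
  rewrite Rmin_left, Rmax_right in Hc by lra.
  destruct (Rpower_MVT (b - 1) x c) as [d [Hd E']]; [lra|lra|].
  rewrite Rmin_left, Rmax_right in Hd by lra.
  rewrite E.
  replace (x * (b * Rpower c (b - 1) * (x + 1 - x) - b * Rpower x (b - 1)))
    with (x * b * (Rpower c (b - 1) - Rpower x (b - 1))) by ring.
  rewrite E'.
  replace (x * b * ((b - 1) * Rpower d (b - 1 - 1) * (c - x)))
    with (b * (b - 1) * (x * Rpower d (b - 1 - 1) * (c - x))) by ring.
  rewrite Rabs_mult. apply Rmult_le_compat_l; [apply Rabs_pos|].
  assert (Hdp := Rpower_pos d (b - 1 - 1)).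
  assert (Hdx : Rpower d (b - 1 - 1) <= Rpower x (b - 1 - 1)).
  { replace (b - 1 - 1) with (- (2 - b)) by ring. apply Rpower_le_neg; lra. }
  assert (Hx : x * Rpower x (b - 1 - 1) = Rpower x (- (1 - b))).
  { rewrite <- (Rpower_1 x) at 1 by lra. rewrite <- Rpower_plus. f_equal. ring. }
  rewrite Rabs_pos_eq.
  2:{ apply Rmult_le_pos; [apply Rmult_le_pos|]; lra. }
  rewrite <- Hx, <- (Rmult_1_r (x * Rpower x (b - 1 - 1))).
  apply Rmult_le_compat; try lra; [apply Rmult_le_pos; lra|].
  apply Rmult_le_compat_l; lra.
- replace (Finite 0) with (Rbar_opp (Rbar_mult (Rabs (b * (b - 1))) 0))
    by (simpl; f_equal; ring).
  apply -> is_lim_seq_opp. apply is_lim_seq_scal_l.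
  apply is_lim_seq_Rpower_neg; [lra|apply is_lim_seq_INR].
- replace (Finite 0) with (Rbar_mult (Rabs (b * (b - 1))) 0) by (simpl; f_equal; ring).
  apply is_lim_seq_scal_l.
  apply is_lim_seq_Rpower_neg; [lra|apply is_lim_seq_INR].
Qed.

Lemma is_lim_seq_sum (u : nat -> nat -> R) (a : nat -> R) K :
  (forall k, (k <= K)%nat -> is_lim_seq (u k) (a k)) ->
  is_lim_seq (fun n => sum_f_R0 (fun k => u k n) K) (sum_f_R0 a K).
Proof.
intros H. induction K as [|K IH]; simpl; [now apply H|].
apply is_lim_seq_plus'; [apply IH; auto|now apply H].
Qed.

(** With the coefficients of ansatz_coefficients, an approximate solution of the
    recursion z (n+1) - z n = increment p N (z n). *)
Definition ansatz (p : R) (N : nat) (alpha : nat -> R) (x : R) : R :=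
  sum_f_R0 (fun k => alpha k * Rpower x ((1 - 2 * p * INR k) / (p + 1))) N.

Lemma ansatz_factor p N alpha x : 0 < p -> 0 < x ->
  ansatz p N alpha x = Rpower x (1 / (p + 1)) *
    sum_f_R0 (fun k => alpha k * Rpower x (- (2 * p / (p + 1))) ^ k) N.
Proof.
intros Hp Hx. unfold ansatz. rewrite scal_sum. apply sum_eq. intros k _.
rewrite Rpower_INR_pow, (Rmult_assoc (alpha k)), <- Rpower_plus. f_equal. f_equal. field. lra.
Qed.

Lemma eventually_small_power p P : 0 < p -> at_right 0 P ->
  eventually (fun n => P (Rpower (INR n) (- (2 * p / (p + 1))))).
Proof.
intros Hp [d Hd].
assert (H : is_lim_seq (fun n => Rpower (INR n) (- (2 * p / (p + 1)))) 0).
{ apply is_lim_seq_Rpower_neg; [apply Rdiv_lt_0_compat; lra|apply is_lim_seq_INR]. }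
generalize (proj2 (is_lim_seq_spec _ _) H d). apply filter_imp. intros n Hn.
apply Hd; [exact Hn|apply Rpower_pos].
Qed.

Lemma ansatz_bounds p N alpha : 0 < p -> 0 < alpha 0%nat ->
  eventually (fun n => 0 < ansatz p N alpha (INR n) /\
    Rpower (alpha 0%nat / 2) (p + 1) * INR n
      <= Rpower (ansatz p N alpha (INR n)) (p + 1)
      <= Rpower (2 * alpha 0%nat) (p + 1) * INR n).
Proof.
intros Hp Ha.
generalize (filter_and _ _ (proj2 (is_lim_seq_spec _ _) is_lim_seq_INR 0)
  (eventually_small_power p _ Hp (bigO_1_small _ _ (Rdiv_lt_0_compat _ 2 Ha Rlt_0_2)
    (bigO_sum_minus_head alpha N)))).
apply filter_imp. intros n [Hn HA]. rewrite ansatz_factor by assumption.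
set (A := sum_f_R0 _ N) in *. apply Rabs_def2 in HA.
assert (Hs := Rpower_pos (INR n) (1 / (p + 1))).
split; [apply Rmult_lt_0_compat; lra|].
rewrite <- Rpower_mult_distr by lra. rewrite Rpower_mult.
replace (1 / (p + 1) * (p + 1)) with 1 by (field; lra). rewrite Rpower_1 by exact Hn.
rewrite (Rmult_comm (INR n)).
split; apply Rmult_le_compat_r; try lra; apply Rle_Rpower_l; lra.
Qed.

(** The forward difference agrees with the derivative up to o(1/n) by power_step.
    The derivative and the increment are both n^(-p/(p+1)) times a function of
    v = n^(-2p/(p+1)), and these two functions differ by O(v^(N+1)); n times
    this error is O(n^((1 - 2p(N+1))/(p+1))), a negative power. *)
Lemma ansatz_step p N alpha : 0 < p -> 0 < alpha 0%nat ->
  1 < 2 * p * INR (S N) ->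
  bigO (S N) (fun v =>
      artanh_sum N v (Rpower (sum_f_R0 (fun k => alpha k * v ^ k) N) (- p))
      - sum_f_R0 (fun k => alpha k * ((1 - 2 * p * INR k) / (p + 1)) * v ^ k) N) ->
  is_lim_seq (fun n => INR n * (ansatz p N alpha (INR (S n)) - ansatz p N alpha (INR n)
                                - increment p N (ansatz p N alpha (INR n)))) 0.
Proof.
intros Hp Ha HN [C HC].
set (beta := fun k => (1 - 2 * p * INR k) / (p + 1)).
set (D := fun n => sum_f_R0 (fun k => alpha k * beta k * Rpower (INR n) (beta k - 1)) N).
apply (is_lim_seq_ext (fun n =>
  INR n * (ansatz p N alpha (INR (S n)) - ansatz p N alpha (INR n) - D n)
  + INR n * (D n - increment p N (ansatz p N alpha (INR n))))).
{ intros n. ring. }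
replace (Finite 0) with (Finite (0 + 0)) by (f_equal; ring).
apply is_lim_seq_plus'.
- apply (is_lim_seq_ext (fun n => sum_f_R0 (fun k => alpha k *
    (INR n * (Rpower (INR (S n)) (beta k) - Rpower (INR n) (beta k)
              - beta k * Rpower (INR n) (beta k - 1)))) N)).
  { intros n. unfold ansatz, D. rewrite <- !minus_sum, scal_sum. apply sum_eq.
    intros k _. fold (beta k). ring. }
  replace 0 with (sum_f_R0 (fun _ => 0) N) by now apply sum_eq_R0.
  apply (is_lim_seq_sum (fun k n => alpha k *
    (INR n * (Rpower (INR (S n)) (beta k) - Rpower (INR n) (beta k)
              - beta k * Rpower (INR n) (beta k - 1)))) (fun _ => 0)). intros k _.
  replace (Finite 0) with (Rbar_mult (alpha k) 0) by (simpl; f_equal; ring).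
  apply is_lim_seq_scal_l, power_step.
  unfold beta. apply (Rmult_lt_reg_r (p + 1)); [lra|].
  unfold Rdiv. rewrite Rmult_assoc, Rinv_l by lra.
  generalize (Rmult_le_pos p (INR k) ltac:(lra) (pos_INR k)). lra.
- set (eta := (2 * p * INR (S N) - 1) / (p + 1)).
  assert (Heta : 0 < eta) by (apply Rdiv_lt_0_compat; lra).
  assert (Hlim : is_lim_seq (fun n => C * Rpower (INR n) (- eta)) 0).
  { replace (Finite 0) with (Rbar_mult C 0) by (simpl; f_equal; ring).
    apply is_lim_seq_scal_l, is_lim_seq_Rpower_neg; [exact Heta|apply is_lim_seq_INR]. }
  apply is_lim_seq_abs_0.
  apply (is_lim_seq_le_le_loc (fun _ => 0) _ (fun n => C * Rpower (INR n) (- eta)));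
    [|apply is_lim_seq_const|exact Hlim].
  generalize (filter_and _ _ (proj2 (is_lim_seq_spec _ _) is_lim_seq_INR 0)
    (filter_and _ _ (eventually_small_power p _ Hp HC)
    (eventually_small_power p _ Hp (bigO_1_small _ _ Ha (bigO_sum_minus_head alpha N))))).
  apply filter_imp. intros n [Hn [Hb HA]]. split; [apply Rabs_pos|].
  rewrite ansatz_factor by assumption.
  set (x := INR n) in *. set (v := Rpower x (- (2 * p / (p + 1)))) in *.
  set (A := sum_f_R0 (fun k => alpha k * v ^ k) N) in *. apply Rabs_def2 in HA.
  set (s := Rpower x (- (p / (p + 1)))).
  assert (Hs2 : s ^ 2 = v).
  { unfold s, v. rewrite Rpower_INR_pow. f_equal. simpl. field. lra. }
  assert (HD : D n = s * sum_f_R0 (fun k => alpha k * beta k * v ^ k) N).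
  { unfold D. rewrite scal_sum. apply sum_eq. intros k _.
    unfold s, v. rewrite Rpower_INR_pow, (Rmult_assoc (alpha k * beta k)), <- Rpower_plus.
    do 2 f_equal. unfold beta. field. lra. }
  assert (HF : increment p N (Rpower x (1 / (p + 1)) * A) = s * artanh_sum N v (Rpower A (- p))).
  { unfold increment. rewrite <- Rpower_mult_distr, Rpower_mult; [|apply Rpower_pos|lra].
    replace (1 / (p + 1) * - p) with (- (p / (p + 1))) by (field; lra).
    fold s. now rewrite artanh_sum_scale, Hs2. }
  rewrite HF, HD.
  set (B := sum_f_R0 (fun k => alpha k * beta k * v ^ k) N).
  fold beta in Hb. change (Rabs (artanh_sum N v (Rpower A (- p)) - B) <= C * v ^ S N) in Hb.
  replace (x * (s * B - s * artanh_sum N v (Rpower A (- p))))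
    with (- (x * s * (artanh_sum N v (Rpower A (- p)) - B))) by ring.
  assert (Hs := Rpower_pos x (- (p / (p + 1)))). fold s in Hs.
  rewrite Rabs_Ropp, Rabs_mult, (Rabs_pos_eq (x * s)) by (apply Rmult_le_pos; lra).
  eapply Rle_trans; [apply Rmult_le_compat_l; [apply Rmult_le_pos; lra|exact Hb]|].
  apply Req_le.
  replace (x * s * (C * v ^ S N)) with (C * (x * s * v ^ S N)) by ring. f_equal.
  unfold s, v. rewrite Rpower_INR_pow. rewrite <- (Rpower_1 x) at 1 by exact Hn.
  rewrite <- !Rpower_plus. f_equal. unfold eta. field. lra.
Qed.

(** Both sequences have exact order n^(1/(p+1)), so the slope of the increment
    between them lies between two negative multiples of 1/n. The difference then
    obeys the hypothesis of contraction_to_0. *)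
Lemma ansatz_approximates p N alpha (z : nat -> R) C r :
  0 < p -> 0 < alpha 0%nat -> p + 1 < r ->
  is_lim_seq z p_infty ->
  eventually (fun n => Rabs (z (S n) - z n - increment p N (z n)) <= C * Rpower (z n) (- r)) ->
  is_lim_seq (fun n => INR n * (ansatz p N alpha (INR (S n)) - ansatz p N alpha (INR n)
                                - increment p N (ansatz p N alpha (INR n)))) 0 ->
  is_lim_seq (fun n => z n - ansatz p N alpha (INR n)) 0.
Proof.
intros Hp Ha Hr Hz Hrec Hans.
assert (Hz0 : eventually (fun n => 0 < z n)) by exact (proj2 (is_lim_seq_spec _ _) Hz 0).
assert (Hzp : eventually (fun n => Rpower (z n) (- p) <= 1 / 2)).
{ generalize (proj2 (is_lim_seq_spec _ _) (is_lim_seq_Rpower_neg z p Hp Hz)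
    (mkposreal (1 / 2) ltac:(lra))).
  apply filter_imp. simpl. intros n Hn. apply Rabs_def2 in Hn. lra. }
(* The increment lies between 2 and 4 times z^(-p), and the error is below
   z^(-p): hence the constants 1 and 5. *)
destruct (increments_growth p z 1 5 Hp ltac:(lra) Hz) as [c1 [C1 [Hc1 Hg]]].
{ assert (Hsmall : is_lim_seq (fun n => C * Rpower (z n) (- (r - p))) 0).
  { replace (Finite 0) with (Rbar_mult C 0) by (simpl; f_equal; ring).
    apply is_lim_seq_scal_l, is_lim_seq_Rpower_neg; [lra|exact Hz]. }
  generalize (filter_and _ _ (filter_and _ _ Hz0 Hzp) (filter_and _ _ Hrec
    (proj2 (is_lim_seq_spec _ _) Hsmall (mkposreal 1 Rlt_0_1)))).
  apply filter_imp. simpl. intros n [[h0 hp] [hrec hs]].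
  generalize (increment_bounds p N _ h0 hp). intros hb.
  assert (hpos := Rpower_pos (z n) (- p)).
  assert (C * Rpower (z n) (- r) <= Rpower (z n) (- p)).
  { replace (- r) with (- (r - p) + - p) by ring. rewrite Rpower_plus, <- Rmult_assoc.
    rewrite <- (Rmult_1_l (Rpower (z n) (- p))) at 2.
    apply Rmult_le_compat_r; [lra|]. apply Rabs_def2 in hs. lra. }
  apply Rabs_le_between in hrec. lra. }
set (S1 := fun n => ansatz p N alpha (INR n)).
set (c2 := Rpower (alpha 0%nat / 2) (p + 1)).
set (C2 := Rpower (2 * alpha 0%nat) (p + 1)).
assert (Hb : eventually (fun n =>
    0 < S1 n /\ c2 * INR n <= Rpower (S1 n) (p + 1) <= C2 * INR n))
  by exact (ansatz_bounds p N alpha Hp Ha).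
assert (Hc2 : 0 < c2) by apply Rpower_pos.
set (c := Rmin c1 c2). set (C' := Rmax C1 C2).
assert (Hc : 0 < c) by now apply Rmin_case.
assert (HC' : 0 < C') by (eapply Rlt_le_trans; [apply Rpower_pos|apply Rmax_r]).
set (rho := fun n => Rabs (z (S n) - z n - increment p N (z n))
   + Rabs (S1 (S n) - S1 n - increment p N (S1 n))).
apply is_lim_seq_abs_0.
apply (contraction_to_0 _ rho (2 * p / C')).
{ apply Rdiv_lt_0_compat; lra. }
{ intros n. apply Rabs_pos. }
2:{ apply (is_lim_seq_ext (fun n => INR n * Rabs (z (S n) - z n - increment p N (z n))
      + Rabs (INR n * (S1 (S n) - S1 n - increment p N (S1 n))))).
    { intros n. unfold rho. rewrite Rabs_mult, (Rabs_pos_eq (INR n)) by apply pos_INR. ring. }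
    replace (Finite 0) with (Finite (0 + 0)) by (f_equal; ring).
    apply is_lim_seq_plus'; [|now apply -> is_lim_seq_abs_0].
    apply (is_lim_seq_le_le_loc (fun _ => 0) _
             (fun n => Rabs C / c1 * Rpower (z n) (- (r - p - 1)))).
    - generalize (filter_and _ _ Hz0 (filter_and _ _ Hrec Hg)). apply filter_imp.
      intros n [h0 [hr [hg _]]]. split; [apply Rmult_le_pos; [apply pos_INR|apply Rabs_pos]|].
      assert (hn : INR n <= / c1 * Rpower (z n) (p + 1)).
      { apply (Rmult_le_reg_l c1); [exact Hc1|]. rewrite <- Rmult_assoc, Rinv_r by lra. lra. }
      apply Rle_trans with ((/ c1 * Rpower (z n) (p + 1)) * (Rabs C * Rpower (z n) (- r))).
      + apply Rmult_le_compat; [apply pos_INR|apply Rabs_pos|exact hn|].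
        eapply Rle_trans; [exact hr|]. apply Rmult_le_compat_r; [apply Rlt_le, Rpower_pos|apply Rle_abs].
      + apply Req_le. replace (- (r - p - 1)) with (p + 1 + - r) by ring.
        rewrite (Rpower_plus (p + 1) (- r)). unfold Rdiv. ring.
    - apply is_lim_seq_const.
    - replace (Finite 0) with (Rbar_mult (Rabs C / c1) 0) by (simpl; f_equal; ring).
      apply is_lim_seq_scal_l, is_lim_seq_Rpower_neg; [lra|exact Hz]. }
assert (HSp : eventually (fun n => Rpower (S1 n) (- p) <= 1 / 2)).
{ generalize (filter_and _ _ Hb (proj2 (is_lim_seq_spec _ _) is_lim_seq_INR
    (Rpower (1 / 2) (- ((p + 1) / p)) / c2))).
  apply filter_imp. intros n [[h0 [h1 _]] h2].
  apply (Rmult_lt_compat_l c2) in h2; [|exact Hc2].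
  replace (c2 * (Rpower (1 / 2) (- ((p + 1) / p)) / c2))
    with (Rpower (1 / 2) (- ((p + 1) / p))) in h2 by (field; lra).
  assert (Hq : 0 < p / (p + 1)) by (apply Rdiv_lt_0_compat; lra).
  replace (Rpower (S1 n) (- p)) with (Rpower (Rpower (S1 n) (p + 1)) (- (p / (p + 1)))).
  2:{ rewrite Rpower_mult. f_equal. field. lra. }
  replace (1 / 2) with (Rpower (Rpower (1 / 2) (- ((p + 1) / p))) (- (p / (p + 1)))).
  2:{ rewrite Rpower_mult. replace (- ((p + 1) / p) * - (p / (p + 1))) with 1 by (field; lra).
      apply Rpower_1. lra. }
  apply Rpower_le_neg; [lra|]. split; [apply Rpower_pos|lra]. }
generalize (filter_and _ _ (filter_and _ _ (filter_and _ _ Hz0 Hzp) (filter_and _ _ Hb HSp))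
  (filter_and _ _ Hg (proj2 (is_lim_seq_spec _ _) is_lim_seq_INR (4 * p / c)))).
apply filter_imp. intros n [[[h0 hp] [[hS0 [hS1 hS2]] hSp]] [[hg1 hg2] hn]].
change (ansatz p N alpha (INR n)) with (S1 n).
change (ansatz p N alpha (INR (S n))) with (S1 (S n)).
assert (hn0 : 0 < INR n).
{ eapply Rlt_trans; [|exact hn]. apply Rdiv_lt_0_compat; lra. }
destruct (increment_MVT p N (S1 n) (z n) Hp hS0 h0) as [x [k [Hx [Hk E]]]].
{ now apply Rmin_case. }
assert (Hx0 : 0 < x) by (eapply Rlt_le_trans; [|apply Hx]; now apply Rmin_case).
assert (Hxlo : c * INR n <= Rpower x (p + 1)).
{ apply Rle_trans with (Rpower (Rmin (S1 n) (z n)) (p + 1)).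
  - apply (Rmin_case _ _ (fun y => c * INR n <= Rpower y (p + 1))).
    + eapply Rle_trans; [|exact hS1]. apply Rmult_le_compat_r; [lra|apply Rmin_r].
    + eapply Rle_trans; [|exact hg1]. apply Rmult_le_compat_r; [lra|apply Rmin_l].
  - apply Rle_Rpower_l; [lra|]. split; [now apply Rmin_case|apply Hx]. }
assert (Hxhi : Rpower x (p + 1) <= C' * INR n).
{ apply Rle_trans with (Rpower (Rmax (S1 n) (z n)) (p + 1)).
  - apply Rle_Rpower_l; [lra|]. split; [exact Hx0|apply Hx].
  - apply (Rmax_case _ _ (fun y => Rpower y (p + 1) <= C' * INR n)).
    + eapply Rle_trans; [exact hS2|]. apply Rmult_le_compat_r; [lra|apply Rmax_r].
    + eapply Rle_trans; [exact hg2|]. apply Rmult_le_compat_r; [lra|apply Rmax_l]. }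
rewrite Rpower_Ropp in E.
set (W := Rpower x (p + 1)) in *. assert (HW : 0 < W) by apply Rpower_pos.
set (lam := p * k * / W) in *.
assert (Hlam : 2 * p / C' / INR n <= lam <= 1).
{ unfold lam. split.
  - replace (2 * p / C' / INR n) with (p * 2 * / (C' * INR n)) by (field; lra).
    apply Rmult_le_compat; [lra| |apply Rmult_le_compat_l; lra|now apply Rinv_le_contravar].
    apply Rlt_le, Rinv_0_lt_compat, Rmult_lt_0_compat; lra.
  - apply (Rmult_le_reg_r W); [exact HW|]. rewrite Rmult_assoc, Rinv_l, Rmult_1_r by lra.
    apply (Rmult_lt_compat_l c) in hn; [|exact Hc].
    replace (c * (4 * p / c)) with (4 * p) in hn by (field; lra).
    apply Rle_trans with (p * 4); [apply Rmult_le_compat_l; lra|lra]. }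
replace (z (S n) - S1 (S n)) with
  ((1 - lam) * (z n - S1 n) + ((z (S n) - z n - increment p N (z n))
    + - (S1 (S n) - S1 n - increment p N (S1 n)))) by lra.
eapply Rle_trans; [apply Rabs_triang|]. apply Rplus_le_compat.
- rewrite Rabs_mult, (Rabs_pos_eq (1 - lam)) by lra.
  apply Rmult_le_compat_r; [apply Rabs_pos|lra].
- eapply Rle_trans; [apply Rabs_triang|]. rewrite Rabs_Ropp. apply Rle_refl.
Qed.

(** * The orbit of Q *)

Lemma continuous_of_derive_Rplus q x l :
  0 < x -> is_derive_Rplus q x l -> continuous q x.
Proof.
intros Hx H. apply (ex_derive_continuous (V := R_NormedModule)).
exists l. apply is_derive_Reals. intros eps Heps.
destruct (proj1 (filterlim_locally _ _) H (mkposreal eps Heps)) as [d Hd].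
assert (Hm : 0 < Rmin d x) by (apply Rmin_case; [apply cond_pos|exact Hx]).
exists (mkposreal _ Hm). intros h Hh Hlt. simpl in Hlt.
assert (H1 : Rabs h < d) by (eapply Rlt_le_trans; [exact Hlt|apply Rmin_l]).
assert (H2 : Rabs h < x) by (eapply Rlt_le_trans; [exact Hlt|apply Rmin_r]).
specialize (Hd (x + h)). replace (x + h - x) with h in Hd by ring.
apply Hd.
- change (Rabs (x + h - x) < d). now replace (x + h - x) with h by ring.
- lra.
- unfold Rplus_set. apply Rabs_def2 in H2. lra.
Qed.

Lemma difference_bigO_of_derive_Rplus q l :
  is_derive_Rplus q 0 l ->
  bigO 1 (fun v => q v - q 0).
Proof.
intros H. exists (Rabs l + 1).
destruct (proj1 (filterlim_locally _ _) H (mkposreal 1 Rlt_0_1)) as [d Hd].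
apply (at_right_0_intro _ d (cond_pos d)). intros v Hv.
assert (Hb : Rabs ((q v - q 0) / (v - 0) - l) < 1).
{ apply (Hd v); [|lra|unfold Rplus_set; lra].
  change (Rabs (v - 0) < d). rewrite Rminus_0_r, Rabs_pos_eq; lra. }
rewrite Rminus_0_r in Hb.
replace (q v - q 0) with (((q v - q 0) / v - l + l) * v) by (field; lra).
rewrite Rabs_mult, (Rabs_pos_eq v), pow_1 by lra.
apply Rmult_le_compat_r; [lra|]. eapply Rle_trans; [apply Rabs_triang|]. lra.
Qed.

(** The bound q x < x leaves q 0 undetermined; it is right continuity at 0 that
    makes it vanish. *)
Lemma q_at_0 q : C1_Rplus q -> (forall x, 0 < x -> 0 < q x < x) -> q 0 = 0.
Proof.
intros [dq [Hd _]] Hlt. apply bigO_1_const.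
apply (bigO_ext 1 (fun v => q v - (q v - q 0))).
{ apply filter_forall. intros v. ring. }
apply bigO_minus.
- exists 1. apply (at_right_0_intro _ 1 Rlt_0_1). intros v Hv.
  rewrite pow_1, Rabs_pos_eq; generalize (Hlt v (proj1 Hv)); lra.
- apply (difference_bigO_of_derive_Rplus q (dq 0)), Hd. unfold Rplus_set; lra.
Qed.

(** As 0 < q < Id, the function q + Id passes through the value y between y/2 and
    y; and q 0 = 0 excludes that the selected preimage is 0. *)
Lemma inv_Rplus_id_plus q y :
  (forall x, 0 < x -> continuous q x) -> (forall x, 0 < x -> 0 < q x < x) -> q 0 = 0 ->
  0 < y ->
  0 < inv_Rplus (fun t => q t + t) y /\
  q (inv_Rplus (fun t => q t + t) y) + inv_Rplus (fun t => q t + t) y = y.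
Proof.
intros Hc Hlt H0 Hy.
assert (Hex : exists x, Rplus_set x /\ q x + x = y).
{ destruct (Ranalysis5.IVT_interv (fun t => q t + t - y) (y / 2) y) as [x [Hx E]].
  - intros x Hx. apply continuity_pt_filterlim.
    apply (continuous_minus (fun t => q t + t) (fun _ => y)); [|apply continuous_const].
    apply (continuous_plus q (fun t => t)); [apply Hc; lra|apply continuous_id].
  - lra.
  - generalize (Hlt (y / 2) ltac:(lra)). lra.
  - generalize (Hlt y Hy). lra.
  - exists x. unfold Rplus_set. lra. }
destruct (epsilon_spec (inhabits 0) (fun x => Rplus_set x /\ q x + x = y) Hex) as [Hu E].
change (epsilon _ _) with (inv_Rplus (fun t => q t + t) y) in Hu, E.
split; [|exact E]. destruct Hu as [Hu|Hu]; [exact Hu|].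
rewrite <- Hu, H0 in E. lra.
Qed.

(** One step of Q is the passage from u + q u to u - q u, up to the factor
    sqrt 2. *)
Lemma orbit_half_steps q x0 :
  (forall x, 0 < x -> continuous q x) -> (forall x, 0 < x -> 0 < q x < x) -> q 0 = 0 ->
  0 < x0 ->
  exists u : nat -> R, forall n, 0 < u n /\
    sqrt 2 * Nat.iter n (Q_of q) x0 = u n + q (u n) /\
    sqrt 2 * Nat.iter (S n) (Q_of q) x0 = u n - q (u n).
Proof.
intros Hc Hlt H0 Hx0. assert (Hs := Rlt_sqrt2_0).
assert (Hpos : forall n, 0 < Nat.iter n (Q_of q) x0 ->
  let u := inv_Rplus (fun t => q t + t) (sqrt 2 * Nat.iter n (Q_of q) x0) in
  0 < u /\ sqrt 2 * Nat.iter n (Q_of q) x0 = u + q u /\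
  sqrt 2 * Nat.iter (S n) (Q_of q) x0 = u - q u).
{ intros n Hn u.
  destruct (inv_Rplus_id_plus q (sqrt 2 * Nat.iter n (Q_of q) x0) Hc Hlt H0) as [Hu E].
  { now apply Rmult_lt_0_compat. }
  fold u in Hu, E. split; [exact Hu|]. split; [lra|].
  simpl. unfold Q_of at 1. fold u. rewrite <- E. field. lra. }
exists (fun n => inv_Rplus (fun t => q t + t) (sqrt 2 * Nat.iter n (Q_of q) x0)).
intros n. apply Hpos. induction n as [|n IH]; [exact Hx0|].
destruct (Hpos n IH) as [Hu [_ E]]. apply (Rmult_lt_reg_l (sqrt 2)); [exact Hs|].
rewrite E, Rmult_0_r. generalize (Hlt _ Hu). lra.
Qed.

(** A positive limit l would be the common limit of y and u, and y n - u n = q (u n)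
    would then give q l = 0. *)
Lemma half_step_orbit_to_0 q (y u : nat -> R) :
  (forall x, 0 < x -> continuous q x) -> (forall x, 0 < x -> 0 < q x < x) ->
  (forall n, 0 < u n /\ y n = u n + q (u n) /\ y (S n) = u n - q (u n)) ->
  is_lim_seq y 0.
Proof.
intros Hc Hlt Hu.
assert (Hy : forall n, y (S n) < u n < y n /\ 0 < y n).
{ intros n. destruct (Hu n) as [H [-> ->]]. generalize (Hlt _ H). lra. }
destruct (ex_finite_lim_seq_decr y 0) as [l Hl].
{ intros n. generalize (Hy n). lra. }
{ intros n. generalize (Hy n). lra. }
assert (Hl0 : 0 <= l).
{ apply (is_lim_seq_le (fun _ => 0) y 0 l); [|apply is_lim_seq_const|exact Hl].
  intros n. generalize (Hy n). lra. }
destruct (Req_dec l 0) as [->|Hne]; [exact Hl|exfalso].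
assert (Hul : is_lim_seq u l).
{ apply (is_lim_seq_le_le (fun n => y (S n)) _ y).
  - intros n. generalize (Hy n). lra.
  - now apply (is_lim_seq_incr_1 y).
  - exact Hl. }
assert (Hq1 : is_lim_seq (fun n => q (u n)) (q l)).
{ apply (is_lim_seq_continuous q u l); [|exact Hul].
  apply continuity_pt_filterlim, Hc. lra. }
assert (Hq0 : is_lim_seq (fun n => q (u n)) (l - l)).
{ apply (is_lim_seq_ext (fun n => y n - u n)).
  - intros n. destruct (Hu n) as [_ [-> _]]. ring.
  - now apply is_lim_seq_minus'. }
apply is_lim_seq_unique in Hq1. apply is_lim_seq_unique in Hq0.
rewrite Hq1 in Hq0. injection Hq0. generalize (Hlt l ltac:(lra)). lra.
Qed.

(** Two errors occur. Truncating the logarithm costs O(tau^(2N+3)). Evaluating the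
    increment at z n instead of at t = - ln (u n) costs
    O(z^(-(p+1)) (t - z)), with t - z = ln (1 + tau) <= z^(-p). Both exponents
    p (2N+3) and 2p + 1 exceed p + 1. *)
Lemma log_orbit_recursion p q d N (y u : nat -> R) : 0 < p -> 0 < d <= 1 ->
  1 < 2 * p * INR (S N) ->
  (forall x, 0 < x < d -> q x = x / Rpower (- ln x) p) ->
  (forall x, 0 < x -> 0 < q x < x) ->
  (forall n, 0 < u n /\ y n = u n + q (u n) /\ y (S n) = u n - q (u n)) ->
  is_lim_seq (fun n => - ln (y n)) p_infty ->
  exists C r, p + 1 < r /\ eventually (fun n =>
    Rabs (- ln (y (S n)) - - ln (y n) - increment p N (- ln (y n)))
      <= C * Rpower (- ln (y n)) (- r)).
Proof.
intros Hp Hd HN Hq Hlt Hu Hz.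
exists (4 + 4 * p), (Rmin (2 * p + 1) (p * INR (2 * N + 3))). split.
{ apply Rmin_case; [lra|]. rewrite S_INR in HN.
  rewrite plus_INR, mult_INR. simpl (INR 2). simpl (INR 3). lra. }
generalize (filter_and _ _
  (proj2 (is_lim_seq_spec _ _) Hz (Rmax 1 (- ln d)))
  (proj2 (is_lim_seq_spec _ _) (is_lim_seq_Rpower_neg _ p Hp Hz) (mkposreal (1 / 2) ltac:(lra)))).
apply filter_imp. intros n [Hn1 Hn2]. simpl in Hn2. apply Rabs_def2 in Hn2.
destruct (Hu n) as [Hu0 [E1 E2]].
set (z := - ln (y n)) in *. set (t := - ln (u n)).
assert (Hz1 : 1 < z) by (eapply Rle_lt_trans; [apply Rmax_l|exact Hn1]).
assert (Hzd : - ln d < z) by (eapply Rle_lt_trans; [apply Rmax_r|exact Hn1]).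
assert (Huy : u n < y n) by (rewrite E1; generalize (Hlt _ Hu0); lra).
assert (Hzt : z < t) by (unfold z, t; generalize (ln_increasing _ _ Hu0 Huy); lra).
assert (Hud : u n < d).
{ apply ln_lt_inv; [exact Hu0|lra|]. unfold t in Hzt. lra. }
set (tau := Rpower t (- p)).
assert (Htau0 : 0 < tau) by apply Rpower_pos.
assert (Htz : tau <= Rpower z (- p)) by (apply Rpower_le_neg; lra).
assert (Eq : q (u n) = u n * tau).
{ rewrite Hq by lra. fold t. unfold tau. rewrite Rpower_Ropp. reflexivity. }
assert (Ez : z = t - ln (1 + tau)).
{ unfold z, t. rewrite E1, Eq. replace (u n + u n * tau) with (u n * (1 + tau)) by ring.
  rewrite ln_mult by lra. ring. }
assert (Ez' : - ln (y (S n)) = t - ln (1 - tau)).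
{ unfold t. rewrite E2, Eq. replace (u n - u n * tau) with (u n * (1 - tau)) by ring.
  rewrite ln_mult by lra. ring. }
assert (Hlog : ln (1 + tau) <= tau).
{ rewrite <- (ln_exp tau) at 2. apply ln_le; [lra|apply exp_ineq1_le]. }
assert (L := ln_minus_artanh_sum N tau ltac:(lra)).
destruct (increment_MVT p N z t Hp) as [c [k [Hc [Hk E]]]]; [lra|lra| |].
{ rewrite Rmin_left by lra. lra. }
rewrite Rmin_left, Rmax_right in Hc by lra.
set (r := Rmin (2 * p + 1) (p * INR (2 * N + 3))).
assert (Hr : forall s, r <= s -> Rpower z (- s) <= Rpower z (- r)).
{ intros s Hs. apply Rle_Rpower; lra. }
replace (- ln (y (S n)) - z - increment p N z)
  with ((ln (1 + tau) - ln (1 - tau) - artanh_sum N 1 tau)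
        + (increment p N t - increment p N z)).
2:{ change (artanh_sum N 1 tau) with (increment p N t). lra. }
rewrite Rmult_plus_distr_r.
eapply Rle_trans; [apply Rabs_triang|]. apply Rplus_le_compat.
- eapply Rle_trans; [exact L|]. apply Rmult_le_compat_l; [lra|].
  apply Rle_trans with (Rpower z (- p) ^ (2 * N + 3)).
  + apply pow_incr. lra.
  + rewrite Rpower_INR_pow. replace (- p * INR (2 * N + 3)) with (- (p * INR (2 * N + 3))) by ring.
    apply Hr, Rmin_r.
- rewrite E. rewrite Rabs_mult, Rabs_Ropp.
  assert (Hcp := Rpower_pos c (- (p + 1))).
  rewrite (Rabs_pos_eq (t - z)) by lra.
  rewrite Rabs_pos_eq by (repeat apply Rmult_le_pos; lra).
  apply Rle_trans with ((p * 4 * Rpower z (- (p + 1))) * Rpower z (- p)).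
  + apply Rmult_le_compat; [repeat apply Rmult_le_pos; lra|lra| |lra].
    apply Rmult_le_compat; [apply Rmult_le_pos; lra|lra|apply Rmult_le_compat_l; lra|].
    apply Rpower_le_neg; lra.
  + rewrite Rmult_assoc, <- Rpower_plus.
    replace (- (p + 1) + - p) with (- (2 * p + 1)) by ring.
    rewrite (Rmult_comm p). apply Rmult_le_compat_l; [lra|]. apply Hr, Rmin_l.
Qed.

Theorem theorem79 (p M : R) (q : R -> R) (x0 : R)
  (hp : 0 < p) (hM : 0 < M < 1)
  (hq_nonneg : forall x, 0 <= x -> 0 <= q x)
  (hq_C1 : C1_Rplus q)
  (hq_formula : forall x, 0 < x < M / sqrt 2 -> q x = x / Rpower (- ln x) p)
  (hq_lt : forall x, 0 < x -> 0 < q x < x)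
  (hq_deriv : forall x, 0 < x -> Rabs (Derive q x) < 1)
  (hx0 : 0 < x0) :
  exists alpha : nat -> R,
    alpha 0%nat = Rpower (2 * (p + 1)) (1 / (p + 1)) /\
    equiv_seq
      (fun n => Nat.iter n (Q_of q) x0)
      (fun n => 1 / sqrt 2 *
         exp (- sum_f_R0 (fun k => alpha k *
                 Rpower (INR n) ((1 - 2 * p * INR k) / (p + 1))) (N_of p))).
Proof.
set (N := N_of p).
assert (HN : 2 * p * INR N <= 1 < 2 * p * INR (S N)).
{ destruct (base_Int_part (1 / (2 * p))) as [H1 H2].
  assert (Hp : 0 < 1 / (2 * p)) by (apply Rdiv_lt_0_compat; lra).
  assert (HI : (0 <= Int_part (1 / (2 * p)))%Z).
  { apply Z.lt_succ_r, lt_IZR. rewrite succ_IZR. lra. }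
  assert (EN : INR N = IZR (Int_part (1 / (2 * p)))).
  { unfold N, N_of. rewrite INR_IZR_INZ, Z2Nat.id by exact HI. reflexivity. }
  rewrite S_INR, EN.
  assert (E1 : 2 * p * (1 / (2 * p)) = 1) by (field; lra).
  apply (Rmult_le_compat_l (2 * p)) in H1; [|lra].
  assert (H3 : 1 / (2 * p) < IZR (Int_part (1 / (2 * p))) + 1) by lra.
  apply (Rmult_lt_compat_l (2 * p)) in H3; lra. }
destruct (ansatz_coefficients p N hp (proj1 HN)) as [alpha [Halpha HO]].
exists alpha. split; [exact Halpha|].
assert (Ha0 : 0 < alpha 0%nat) by (rewrite Halpha; apply Rpower_pos).
assert (Hs := Rlt_sqrt2_0).
assert (Hs1 : 1 < sqrt 2) by (rewrite <- sqrt_1 at 1; apply sqrt_lt_1; lra).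
assert (Hc : forall x, 0 < x -> continuous q x).
{ intros x Hx. destruct hq_C1 as [dq [Hd _]].
  apply (continuous_of_derive_Rplus q x (dq x) Hx), Hd. unfold Rplus_set; lra. }
destruct (orbit_half_steps q x0 Hc hq_lt (q_at_0 q hq_C1 hq_lt) hx0) as [u Hu].
set (y := fun n => sqrt 2 * Nat.iter n (Q_of q) x0).
assert (Hu' : forall n, 0 < u n /\ y n = u n + q (u n) /\ y (S n) = u n - q (u n))
  by exact Hu.
assert (Hy : forall n, 0 < y n).
{ intros n. destruct (Hu' n) as [H [-> _]]. generalize (hq_lt _ H). lra. }
assert (Hy0 := half_step_orbit_to_0 q y u Hc hq_lt Hu').
set (z := fun n => - ln (y n)).
assert (Hz : is_lim_seq z p_infty).
{ apply is_lim_seq_spec. intros A.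
  generalize (proj2 (is_lim_seq_spec _ _) Hy0 (mkposreal _ (exp_pos (- A)))).
  apply filter_imp. simpl. intros n Hn. rewrite Rminus_0_r in Hn. apply Rabs_def2 in Hn.
  unfold z. generalize (ln_increasing _ _ (Hy n) (proj1 Hn)). rewrite ln_exp. lra. }
assert (HMd : 0 < M / sqrt 2 <= 1).
{ split; [apply Rdiv_lt_0_compat; lra|]. apply (Rmult_le_reg_r (sqrt 2)); [exact Hs|].
  unfold Rdiv. rewrite Rmult_assoc, Rinv_l; lra. }
destruct (log_orbit_recursion p q (M / sqrt 2) N y u hp HMd (proj2 HN) hq_formula hq_lt Hu' Hz)
  as [C [r [Hr Hrec]]].
assert (Hlim := ansatz_approximates p N alpha z C r hp Ha0 Hr Hz Hrec
  (ansatz_step p N alpha hp Ha0 (proj2 HN) HO)).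
unfold equiv_seq.
apply (is_lim_seq_ext (fun n => exp (- (z n - ansatz p N alpha (INR n))))).
{ intros n. fold (ansatz p N alpha (INR n)).
  replace (- (z n - ansatz p N alpha (INR n))) with (ln (y n) + ansatz p N alpha (INR n))
    by (unfold z; ring).
  rewrite exp_plus, exp_ln, exp_Ropp by apply Hy. unfold y. field.
  split; [apply Rgt_not_eq, exp_pos|lra]. }
rewrite <- exp_0. rewrite <- Ropp_0.
apply (is_lim_seq_continuous exp); [apply derivable_continuous_pt, derivable_pt_exp|].
exact (proj1 (is_lim_seq_opp _ 0) Hlim).
Qed.
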